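(* Let $n\ge 2$, let $A\subset\mathbb{R}^n$ be a compact set with outradius $R$, and let $u_1,\dots,u_n$ be linearly independent unit vectors in $\mathbb{R}^n$. Then $$\mathrm{Per}(S_{u_n}\cdots S_{u_1}A)\ \le\ \frac{a_nR^{n-1}}{|\det(u_1,\dots,u_n)|},\qquad\text{where } a_n=2n\omega_{n-1}.$$
   Context: Here $\omega_m$ denotes the volume of the closed unit ball of $\mathbb{R}^m$, and $\det(u_1,\dots,u_n)$ is the determinant of the matrix with columns $u_1,\dots,u_n$. The outradius of $A$ is the smallest $R\ge 0$ such that $A$ is contained in some closed ball of radius $R$. Perimeter: for Lebesgue measurable $A\subset\mathbb{R}^n$, $\mathrm{Per}(A)=\sup\int_A \mathrm{div}\,F(x)\,dx\in[0,\infty]$ is the Caccioppoli perimeter, where the supremum runs over all smooth compactly supported vector fields $F$ on $\mathbb{R}^n$ with $\|F\|_\infty\le 1$. Steiner symmetrization: for a compact set $A\subset\mathbb{R}^n$ and a unit vector $u$, set $A(x)=\{t\in\mathbb{R}: x+tu\in A\}$ for $x\in u^\perp$. Then $S_uA$ is the set $\{x+tu:\ x\in u^\perp,\ A(x)\neq\emptyset,\ |t|\le \tfrac12|A(x)|\}$, where $|A(x)|$ is the one-dimensional Lebesgue measure of $A(x)$. That is, each non-empty cross section is replaced by the closed centered interval of the same length, which is the single point $t=0$ if $A(x)$ is non-empty of measure zero; empty cross sections stay empty. The set $S_uA$ is again compact. $S_{u_n}\cdots S_{u_1}A$ means: first apply $S_{u_1}$, then $S_{u_2}$, and so on. *)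

(* Defs.v *)
From HB Require Import structures.
From mathcomp Require Import all_boot all_order all_algebra.
From mathcomp Require Import all_classical all_reals all_analysis.

Set Implicit Arguments.
Unset Strict Implicit.
Unset Printing Implicit Defensive.

Import Order.TTheory GRing.Theory Num.Theory.
Import numFieldNormedType.Exports.

Local Open Scope classical_set_scope.
Local Open Scope ring_scope.

Definition rV_display : measure_display.
Proof. exact: default_measure_display. Qed.

(* The Borel sigma-algebra of R^n, generated by the coordinate projections
   (as the library does for [n.-tuple T]). *)
Section measurable_rV.
Context {R : realType} (n : nat).

Let coord (i : 'I_n) (x : 'rV[R]_n) : measurableTypeR R := x 0 i.

Let rV_set0 : g_sigma_preimage coord set0.
Proof. exact: sigma_algebra0. Qed.

Let rV_setC A : g_sigma_preimage coord A -> g_sigma_preimage coord (~` A).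
Proof. exact: sigma_algebraC. Qed.

Let rV_bigcup (F : (set 'rV[R]_n)^nat) :
  (forall i, g_sigma_preimage coord (F i)) ->
  g_sigma_preimage coord (\bigcup_i F i).
Proof. exact: sigma_algebra_bigcup. Qed.

HB.instance Definition _ := @isMeasurable.Build rV_display
  'rV[R]_n (g_sigma_preimage coord) rV_set0 rV_setC rV_bigcup.

Lemma measurable_coord (i : 'I_n) :
  measurable_fun [set: 'rV[R]_n] (fun x => x 0 i : measurableTypeR R).
Proof.
move=> _ Y mY; rewrite setTI; apply: sub_sigma_algebra => /=.
rewrite -bigcup_seq/=; exists i => /=; first by rewrite mem_index_enum.
by exists Y => //; rewrite setTI.
Qed.

Lemma measurable_fun_rV d (T : measurableType d) (f : T -> 'rV[R]_n) :
  (forall i, measurable_fun [set: T] (fun t => f t 0 i : measurableTypeR R)) ->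
  measurable_fun [set: T] f.
Proof.
move=> mf _ A; rewrite setTI /measurable/=.
pose G := [set B : set 'rV[R]_n | measurable (f @^-1` B)].
suff : g_sigma_preimage coord `<=` G by apply.
apply: smallest_sub.
  split; rewrite /G/=.
  - by rewrite preimage_set0.
  - by move=> B mB; rewrite setTD preimage_setC; exact: measurableC.
  - by move=> F mF; rewrite preimage_bigcup; exact: bigcup_measurable.
rewrite -bigcup_seq/= => B [i _ [C mC <-]].
by rewrite /G/= setTI -[X in measurable X]setTI; exact: (mf i).
Qed.

End measurable_rV.

Section lebesgue_measure_rV.
Context {R : realType}.

Definition rV_cons (n : nat) (p : measurableTypeR R * 'rV[R]_n) : 'rV[R]_n.+1 :=
  row_mx (const_mx p.1 : 'rV[R]_1) p.2.

Definition rV_uncons (n : nat) (x : 'rV[R]_n.+1) :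
  measurableTypeR R * 'rV[R]_n := (x 0 0, rsubmx (x : 'rV[R]_(1 + n))).

Lemma rV_consK (n : nat) : cancel (@rV_cons n) (@rV_uncons n).
Proof.
move=> [a x]; rewrite /rV_uncons /rV_cons row_mxKr/=; congr pair.
rewrite mxE; case: (@split_ordP 1 n 0) => j; first by rewrite mxE.
by move=> /(congr1 val).
Qed.

Lemma rV_unconsK (n : nat) : cancel (@rV_uncons n) (@rV_cons n).
Proof.
move=> x; apply/rowP => i; rewrite /rV_cons.
case: (@split_ordP 1 n i) => j ->; last by rewrite (@row_mxEr _ 1 1 n) mxE.
rewrite (@row_mxEl _ 1 1 n) mxE/=; congr (x _ _); apply/val_inj.
by rewrite /= (ord1 j).
Qed.

Lemma measurable_rV_cons (n : nat) : measurable_fun setT (@rV_cons n).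
Proof.
apply: measurable_fun_rV => i.
case: (@split_ordP 1 n i) => j ->.
- by under eq_fun do rewrite (@row_mxEl _ 1 1 n) mxE; exact: measurable_fst.
- under eq_fun do rewrite (@row_mxEr _ 1 1 n).
  exact: (measurableT_comp (measurable_coord j) measurable_snd).
Qed.

Lemma measurable_rV_uncons (n : nat) : measurable_fun setT (@rV_uncons n).
Proof.
apply: measurable_fun_pair; first exact: measurable_coord.
apply: measurable_fun_rV => i; under eq_fun do rewrite mxE.
exact: measurable_coord.
Qed.

Section step.
Variables (n : nat) (m : {sigma_finite_measure set 'rV[R]_n -> \bar R}).

Definition leb_cons : set 'rV[R]_n.+1 -> \bar R :=
  pushforward (lebesgue_measure \x m)%E (@rV_cons n).

Let leb_cons0 : leb_cons set0 = 0%E.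
Proof. by rewrite /leb_cons /pushforward preimage_set0 measure0. Qed.

Let leb_cons_ge0 A : (0 <= leb_cons A)%E.
Proof. by rewrite /leb_cons /pushforward measure_ge0. Qed.

Let leb_cons_sigma_additive : semi_sigma_additive leb_cons.
Proof.
move=> F mF tF mUF; rewrite /leb_cons /pushforward preimage_bigcup.
have mc B : measurable B -> measurable (@rV_cons n @^-1` B).
  by move=> mB; rewrite -[X in measurable X]setTI; exact: measurable_rV_cons.
apply: measure_semi_sigma_additive.
- by move=> k; exact: mc.
- apply/trivIsetP => /= i j _ _ ij; rewrite -preimage_setI.
  by move/trivIsetP : tF => /(_ _ _ _ _ ij) ->//; rewrite preimage_set0.
- by rewrite -preimage_bigcup; exact: mc.
Qed.

HB.instance Definition _ := isMeasure.Build _ _ _ leb_cons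
  leb_cons0 leb_cons_ge0 leb_cons_sigma_additive.

Let leb_cons_sigma_finite : sigma_finite setT leb_cons.
Proof.
have /sigma_finiteP[F [TF ndF Foo]] := sigma_finiteT (@lebesgue_measure R).
have /sigma_finiteP[G [TG ndG Goo]] := sigma_finiteT m.
exists (fun k => @rV_uncons n @^-1` (F k `*` G k)).
  rewrite -preimage_bigcup -(@preimage_setT _ _ (@rV_uncons n)); congr preimage.
  rewrite -setXTT TF TG predeqE => -[x y]; split.
    move=> [/= [i _ Fix] [k _ Gky]]; exists (maxn i k) => //; split.
    - by move: x Fix; exact/subsetPset/ndF/leq_maxl.
    - by move: y Gky; exact/subsetPset/ndG/leq_maxr.
  by move=> [i _ []/= ? ?]; split; exists i.
move=> k; have [mF Fk] := Foo k; have [mG Gk] := Goo k; split.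
  rewrite -[X in measurable X]setTI; apply: measurable_rV_uncons => //.
  exact: measurableX.
rewrite /leb_cons /pushforward -comp_preimage (_ : _ \o _ = id); last first.
  by apply/funext => p /=; rewrite rV_consK.
by rewrite preimage_id product_measure1E// lte_mul_pinfty// ge0_fin_numE.
Qed.

HB.instance Definition _ := Measure_isSigmaFinite.Build _ _ _ leb_cons
  leb_cons_sigma_finite.

End step.

(* n-fold product of the one-dimensional Lebesgue measure. It lives on the Borel
   sigma-algebra (no completion), which contains the compact sets. *)
Fixpoint leb (n : nat) : {sigma_finite_measure set 'rV[R]_n -> \bar R} :=
  match n with
  | 0 => \d_(0 : 'rV[R]_0)
  | m.+1 => leb_cons (leb m)
  end.

End lebesgue_measure_rV.

Section euclidean.
Context {R : realType} {n : nat}.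
Implicit Types (x y u c : 'rV[R]_n) (A : set 'rV[R]_n).

Definition dotv x y : R := \sum_(i < n) x 0 i * y 0 i.

(* The library's norm on ['rV[R]_n] is the sup norm; it only serves for the
   topology and differentiability. *)
Definition enorm x : R := Num.sqrt (dotv x x).

Definition eball c (r : R) : set 'rV[R]_n := [set x | enorm (x - c) <= r].

Definition is_outradius A (r : R) :=
  let radii := [set s : R | 0 <= s /\ exists c, A `<=` eball c s] in
  radii r /\ lbound radii r.

Definition fiber A u x : set R := [set t | A (x + t *: u)].

Definition steiner u A : set 'rV[R]_n :=
  [set y | exists x t, [/\ dotv x u = 0, y = x + t *: u, fiber A u x !=set0 &
    (`|t|%:E <= (2^-1)%:E * lebesgue_measure (fiber A u x))%E]].

(* [iter_steiner [:: u_1; ..; u_k] A] applies the symmetrization along [u_1]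
   first. *)
Definition iter_steiner (us : seq 'rV[R]_n) A : set 'rV[R]_n :=
  foldl (fun B u => steiner u B) A us.

Definition evec (i : 'I_n) : 'rV[R]_n := delta_mx 0 i.

Fixpoint Ck (k : nat) (F : 'rV[R]_n -> 'rV[R]_n) : Prop :=
  match k with
  | 0 => continuous F
  | j.+1 => (forall x, differentiable F x) /\
            (forall v, Ck j (fun x => 'D_v F x))
  end.

Definition smooth (F : 'rV[R]_n -> 'rV[R]_n) := forall k, Ck k F.

Definition compactly_supported (F : 'rV[R]_n -> 'rV[R]_n) :=
  compact (closure [set x | F x != 0]).

Definition divergence (F : 'rV[R]_n -> 'rV[R]_n) x : R :=
  \sum_(i < n) 'D_(evec i) (fun y => F y 0 i) x.

Definition perimeter A : \bar R :=
  ereal_sup [set (\int[leb n]_(x in A) (divergence F x)%:E)%E | F in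
    [set F | [/\ smooth F, compactly_supported F & forall x, enorm (F x) <= 1]]].

End euclidean.

Definition unit_ball_volume (R : realType) (m : nat) : \bar R :=
  leb m (eball (0 : 'rV[R]_m) 1).

(* Main.v *)
Require Import Defs.
From mathcomp Require Import all_boot all_order all_algebra.
From mathcomp Require Import finmap all_classical all_reals all_analysis.
From mathcomp Require Import measurable_realfun ring lra.

(** Why the bound holds.  For a set [A] and a vector [w], compare the volume of
[A] with the volume of its overlap with the translate [A + h w]; if the loss is
at most [L |h|] for every [h], then [2 L] bounds the total variation of the
derivative of the indicator of [A] in the direction [w] ([translation_loss_le]).
Let [K] be the volume of an [(n-1)]-dimensional ball of radius [r].

Right after symmetrization along [u] the lines parallel to [u] meet the set in
intervals, each of which loses at most [|h|], and these lines are indexed by a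
set contained in an [(n-1)]-ball of radius [r]: the loss along [u] is at most
[K |h|] ([steiner_self_loss]).  A later symmetrization along [v] does not
preserve this bound for [u], but it does so for the projection of [u] onto the
hyperplane orthogonal to [v] ([steiner_translation_loss]): on a line parallel
to [v] the overlap of two fibers of [A] is at most the length of the shorter
one, whatever their positions, and for centered intervals this is attained
([steiner_overlap]).

So after all [n] steps there are vectors [w_i], obtained from the [u_i] by
projecting successively along the later [u_j], with loss at most [K |h|] each.
Each projection subtracts a multiple of a vector that is still among the rows,
hence [det (w_i) = det (u_i)], and the [w_i] have length at most one
([iterated_translation_loss]).

Finally write a test field as [F = g_1 w_1 + ... + g_n w_n].  Then the
divergence of [F] is the sum of the derivatives of the [g_i] along the [w_i],
and [|g_i| <= 1 / |det (w_i)|] by Cramer's rule and Hadamard's inequality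
([coordinate_le_inv_det]).  Approximating the derivatives by difference
quotients and moving the translation from the function to the set, each term
integrates to at most [2 K / |det (w_i)|] ([directional_integral_le]); there are
[n] terms.

The measure-theoretic input is that Lebesgue measure of dimension [n], an
iterated product, is multiplied by [|det M|] under a linear map [M]
([leb_mulmx]).  This gives slicing along an arbitrary unit vector
([leb_fibers]) and the volume of balls ([leb_eball]). *)

Set Implicit Arguments.
Unset Strict Implicit.
Unset Printing Implicit Defensive.

Import Order.TTheory GRing.Theory Num.Theory.
Import numFieldNormedType.Exports.

Local Open Scope classical_set_scope.
Local Open Scope ring_scope.

(** * Euclidean geometry and Hadamard's inequality *)

Section dot_product.
Context {R : realType} {n : nat}.
Implicit Types (x y z u v w c : 'rV[R]_n) (a : R).

Lemma dotvE x y : dotv x y = (x *m y^T) 0 0.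
Proof. by rewrite mxE; apply: eq_bigr => i _; rewrite mxE. Qed.

Lemma dotvC x y : dotv x y = dotv y x.
Proof. by apply: eq_bigr => i _; rewrite mulrC. Qed.

Lemma dotvDl x y z : dotv (x + y) z = dotv x z + dotv y z.
Proof. by rewrite !dotvE mulmxDl mxE. Qed.

Lemma dotvZl a x y : dotv (a *: x) y = a * dotv x y.
Proof. by rewrite !dotvE -scalemxAl mxE. Qed.

Lemma dotvNl x y : dotv (- x) y = - dotv x y.
Proof. by rewrite -scaleN1r dotvZl mulN1r. Qed.

Lemma dotvDr x y z : dotv z (x + y) = dotv z x + dotv z y.
Proof. by rewrite dotvC dotvDl !(dotvC z). Qed.

Lemma dotvZr a x y : dotv x (a *: y) = a * dotv x y.
Proof. by rewrite dotvC dotvZl dotvC. Qed.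

Lemma dotvNr x y : dotv x (- y) = - dotv x y.
Proof. by rewrite dotvC dotvNl dotvC. Qed.

Definition dotv_lin := (dotvDl, dotvDr, dotvNl, dotvNr, dotvZl, dotvZr).

Lemma dotv_ge0 x : 0 <= dotv x x.
Proof. by apply: sumr_ge0 => i _; rewrite -expr2 sqr_ge0. Qed.

Lemma sqr_coord_le_dotv x i : x 0 i ^+ 2 <= dotv x x.
Proof.
rewrite /dotv (bigD1 i)//= -expr2 lerDl.
by apply: sumr_ge0 => j _; rewrite -expr2 sqr_ge0.
Qed.

Lemma dotv_eq0 x : dotv x x = 0 -> x = 0.
Proof.
move=> x0; apply/rowP => i; rewrite mxE; apply/eqP.
rewrite -sqrf_eq0 eq_le sqr_ge0 andbT.
by rewrite (le_trans (sqr_coord_le_dotv x i))// x0.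
Qed.

Lemma enorm_le x a : 0 <= a -> (enorm x <= a) = (dotv x x <= a ^+ 2).
Proof.
move=> a0; rewrite /enorm -{1}(ger0_norm a0) -sqrtr_sqr ler_sqrt//.
by rewrite sqr_ge0.
Qed.

Lemma enorm1P x : enorm x = 1 -> dotv x x = 1.
Proof. by move=> /(congr1 (fun a => a ^+ 2)); rewrite sqr_sqrtr ?dotv_ge0 ?expr1n. Qed.

Lemma mx_norm_le_enorm x : `|x| <= enorm x.
Proof.
rewrite [leLHS]/Num.Def.normr/= mx_normrE (bigmax_le _ (sqrtr_ge0 _))//= => -[i j] _ /=.
by rewrite -sqrtr_sqr ler_sqrt ?dotv_ge0// (ord1 i) sqr_coord_le_dotv.
Qed.

(** For a unit vector [u], the orthogonal projection onto the hyperplane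
orthogonal to [u]. *)
Definition perp u x : 'rV[R]_n := x - dotv x u *: u.

Lemma perpK u x : perp u x + dotv x u *: u = x.
Proof. by rewrite /perp subrK. Qed.

Lemma dotv_perp u x : dotv u u = 1 -> dotv (perp u x) u = 0.
Proof. by move=> u1; rewrite /perp !dotv_lin u1 mulr1 subrr. Qed.

Lemma dotv_perp_sqr u x : dotv u u = 1 ->
  dotv (perp u x) (perp u x) = dotv x x - dotv x u ^+ 2.
Proof. by move=> u1; rewrite /perp !dotv_lin u1 (dotvC u x); ring. Qed.

Lemma dotv_perp_le u x : dotv u u = 1 -> dotv (perp u x) (perp u x) <= dotv x x.
Proof. by move=> u1; rewrite dotv_perp_sqr// gerBl sqr_ge0. Qed.

End dot_product.

Lemma dotv_isometry {R : realType} n (Q : 'M[R]_n) (x y : 'rV[R]_n) :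
  Q *m Q^T = 1%:M -> dotv (x *m Q) (y *m Q) = dotv x y.
Proof. by move=> QQ; rewrite !dotvE trmx_mul mulmxA -(mulmxA x) QQ mulmx1. Qed.

(** The Householder reflection that exchanges [v] and the first basis vector. *)
Lemma orthogonal_extension {R : realType} m (v : 'rV[R]_m.+1) : dotv v v = 1 ->
  exists2 Q : 'M[R]_m.+1, Q *m Q^T = 1%:M & row 0 Q = v.
Proof.
move=> v1; set e : 'rV[R]_m.+1 := delta_mx 0 0.
have e1 : dotv e e = 1.
  rewrite /dotv (bigD1 0)//= !mxE !eqxx mulr1 big1 ?addr0// => i i0.
  by rewrite mxE (negbTE i0) mulr0.
have [->|ve] := eqVneq v e.
  exists 1%:M; first by rewrite trmx1 mulmx1.
  by rewrite row1.
have [d def_d] : exists d, d = v - e by exists (v - e).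
pose a := 2 / dotv d d.
have d0 : dotv d d != 0.
  by apply: contra_neq ve => /dotv_eq0/eqP; rewrite def_d subr_eq0 => /eqP.
have adE : dotv e d * a = -1.
  have dE : dotv d d = - 2 * dotv e d.
    by rewrite def_d !dotv_lin v1 e1 (dotvC v e); ring.
  have : dotv e d != 0 by apply: contra_neq d0 => h; rewrite dE h mulr0.
  by move=> ed0; rewrite /a dE; field.
have mulQ (x : 'rV_m.+1) : x *m (1%:M - a *: (d^T *m d)) = x - (a * dotv x d) *: d.
  rewrite mulmxBr mulmx1 -scalemxAr mulmxA; congr (_ - _).
  rewrite (_ : x *m d^T = (dotv x d)%:M); first by rewrite mul_scalar_mx scalerA.
  by rewrite dotvE -mx11_scalar.
exists (1%:M - a *: (d^T *m d)).
  have -> : (1%:M - a *: (d^T *m d))^T = 1%:M - a *: (d^T *m d).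
    by rewrite linearB/= linearZ/= trmx1 trmx_mul trmxK.
  apply/row_matrixP => i; rewrite row_mul.
  have -> : row i (1%:M - a *: (d^T *m d)) = row i 1%:M *m (1%:M - a *: (d^T *m d)).
    by rewrite -row_mul mul1mx.
  rewrite !mulQ; set x := row i 1%:M.
  rewrite -addrA -opprD -scalerDl (_ : a * dotv x d + _ = 0) ?scale0r ?subr0//.
  by rewrite !dotv_lin /a; field.
have -> : row 0 (1%:M - a *: (d^T *m d)) = e *m (1%:M - a *: (d^T *m d)).
  by rewrite /e rowE.
by rewrite mulQ mulrC adE scaleN1r opprK def_d addrC subrK.
Qed.

Lemma orthogonal_det {R : realType} n (Q : 'M[R]_n) :
  Q *m Q^T = 1%:M -> `|\det Q| = 1.
Proof.
move=> /(congr1 determinant); rewrite det_mulmx det_tr det1 => QQ.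
by rewrite -sqrtr_sqr expr2 QQ sqrtr1.
Qed.

(** An isometry taking the direction of the first row to the first axis keeps
[|det|] and the lengths of the rows.  It turns the determinant into the length
of the first row times a minor, whose rows are truncated rows. *)
Lemma hadamard {R : realType} n (M : 'M[R]_n) :
  (forall i, dotv (row i M) (row i M) <= 1) -> `|\det M| <= 1.
Proof.
elim: n M => [M _|n IH M M1]; first by rewrite det_mx00 normr1.
have [w0|w0] := eqVneq (row 0 M) 0.
  suff -> : \det M = 0 by rewrite normr0.
  rewrite (expand_det_row _ 0) big1// => j _.
  by move/rowP: w0 => /(_ j); rewrite !mxE => ->; rewrite mul0r.
set w := row 0 M in w0; pose a := enorm w.
have a0 : a != 0.
  apply: contra_neq w0 => /eqP; rewrite sqrtr_eq0 => w0.
  by apply/dotv_eq0/le_anti; rewrite w0 dotv_ge0.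
have aw : dotv w w = a ^+ 2 by rewrite sqr_sqrtr ?dotv_ge0.
have [|Q QQ Qw] := @orthogonal_extension R n (a^-1 *: w).
  by rewrite !dotv_lin aw; field.
pose N : 'M[R]_(1 + n) := M *m Q^T.
have QQ' : Q^T *m (Q^T)^T = 1%:M by rewrite trmxK; apply: mulmx1C.
have N1 i : dotv (row i N) (row i N) <= 1.
  by rewrite row_mul dotv_isometry.
have N0 : row 0 N = a *: delta_mx 0 0.
  rewrite row_mul -/w -[w](scalerKV a0) -Qw rowE -scalemxAl -mulmxA QQ mulmx1//.
have -> : `|\det M| = `|\det N|.
  by rewrite det_mulmx normrM (orthogonal_det QQ') mulr1.
have ur0 : ursubmx N = 0.
  apply/matrixP => i j; rewrite (ord1 i) !mxE.
  move/rowP: N0 => /(_ (rshift 1 j)); rewrite !mxE.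
  rewrite (_ : lshift n 0 = 0) => [->|]; last exact/val_inj.
  by rewrite (_ : rshift 1 j == 0 = false) ?andbF ?mulr0.
rewrite -(submxK N) ur0 det_lblock normrM det_mx11.
rewrite mulr_ile1//.
  rewrite !mxE -sqrtr_sqr -[leRHS]sqrtr1 ler_sqrt//.
  apply: le_trans (N1 0); rewrite (le_trans _ (sqr_coord_le_dotv _ 0))//.
  by rewrite !mxE (_ : lshift n 0 = 0)//; exact/val_inj.
apply: IH => i; apply: le_trans (N1 (rshift 1 i)).
rewrite /dotv [leRHS](@big_split_ord _ _ _ 1 n)/= big_ord1 -expr2.
under eq_bigr do rewrite !mxE.
under [X in _ <= _ + X]eq_bigr do rewrite !mxE.
by rewrite lerDr sqr_ge0.
Qed.

(** Cramer's rule: the numerators are determinants of matrices whose rows all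
have length at most one, to which Hadamard's inequality applies. *)
Lemma coordinate_le_inv_det {R : realType} n (W : 'M[R]_n) (x : 'rV[R]_n) i :
  (forall j, dotv (row j W) (row j W) <= 1) -> dotv x x <= 1 -> \det W != 0 ->
  `|(x *m invmx W) 0 i| <= `|\det W|^-1.
Proof.
move=> W1 x1 W0; rewrite /invmx unitmxE unitfE W0 -scalemxAr mxE normrM normfV.
rewrite ler_piMr ?invr_ge0//.
pose Wx : 'M[R]_n := \matrix_(j, k) (if j == i then x 0 k else W j k).
have -> : (x *m \adj W) 0 i = \det Wx.
  rewrite (expand_det_row _ i) mxE; apply: eq_bigr => j _.
  rewrite !mxE eqxx; congr (_ * _); rewrite /cofactor; congr (_ * \det _).
  by apply/matrixP => k l; rewrite !mxE eq_sym (negbTE (neq_lift _ _)).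
apply: hadamard => j; have [ji|ji] := eqVneq j i.
  rewrite (_ : row j Wx = x)//; apply/rowP => k; rewrite !mxE ji eqxx//.
rewrite (_ : row j Wx = row j W)//; apply/rowP => k; rewrite !mxE (negbTE ji)//.
Qed.

(** * Slices of Lebesgue measure and translations *)

Section slicing.
Context {R : realType}.
Local Open Scope ereal_scope.
Notation lambda := (@lebesgue_measure R).

Lemma measurable_preimage d1 d2 (T1 : measurableType d1) (T2 : measurableType d2)
    (f : T1 -> T2) (B : set T2) :
  measurable_fun setT f -> measurable B -> measurable [set x | B (f x)].
Proof. by move=> mf mB; rewrite -[X in measurable X]setTI; exact: mf. Qed.

Lemma leb_slice_rest n (B : set 'rV[R]_n.+1) : measurable B ->
  leb n.+1 B = \int[lambda]_t leb n [set y | B (rV_cons (t, y))].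
Proof.
move=> mB; apply: eq_integral => t _ /=; congr (leb n _).
by apply/seteqP; split => y /=; rewrite /xsection/= inE.
Qed.

(** The product measure is defined by integrating over the first factor; it is
determined by its values on rectangles, so the other order gives the same. *)
Lemma leb_slice_head n (B : set 'rV[R]_n.+1) : measurable B ->
  leb n.+1 B = \int[leb n]_y lambda [set t | B (rV_cons (t, y))].
Proof.
move=> mB; have mB' := measurable_preimage (@measurable_rV_cons R n) mB.
rewrite [LHS](@product_measure_unique _ _ _ _ _ _ _
  (product_measure2 lambda (leb n) : {measure set _ -> \bar R}))//.
  apply: eq_integral => y _ /=; congr (lambda _).
  by apply/seteqP; split => t /=; rewrite /ysection/= inE.
by move=> A1 A2 mA1 mA2; rewrite -product_measure2E.
Qed.

Lemma measurable_leb_slice n (B : set 'rV[R]_n.+1) : measurable B ->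
  measurable_fun setT (fun t => leb n [set y | B (rV_cons (t, y))]).
Proof.
move=> mB; have mB' := measurable_preimage (@measurable_rV_cons R n) mB.
have := measurable_fun_xsection (leb n) mB'.
apply: eq_measurable_fun => t _ /=; congr (leb n _).
by apply/seteqP; split => y /=; rewrite /xsection/= inE.
Qed.

Lemma measurable_head_slice n (B : set 'rV[R]_n.+1) : measurable B ->
  measurable_fun setT (fun y => lambda [set t | B (rV_cons (t, y))]).
Proof.
move=> mB; have mB' := measurable_preimage (@measurable_rV_cons R n) mB.
have := measurable_fun_ysection lambda mB'.
apply: eq_measurable_fun => t _ /=; congr (lambda _).
by apply/seteqP; split => y /=; rewrite /ysection/= inE.
Qed.

Lemma measurable_cons_rest n (B : set 'rV[R]_n.+1) t : measurable B ->
  measurable [set y | B (rV_cons (t, y))].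
Proof.
move=> mB; apply: measurable_preimage mB.
by apply: (measurableT_comp (@measurable_rV_cons R n)); exact: measurable_pair1.
Qed.

Lemma measurable_cons_head n (B : set 'rV[R]_n.+1) y : measurable B ->
  measurable [set t | B (rV_cons (t, y))].
Proof.
move=> mB; apply: measurable_preimage mB.
by apply: (measurableT_comp (@measurable_rV_cons R n)); exact: measurable_pair2.
Qed.

Lemma measurable_mulmxr n p (M : 'M[R]_(n, p)) :
  measurable_fun setT (fun x : 'rV[R]_n => x *m M).
Proof.
apply: measurable_fun_rV => i; under eq_fun do rewrite mxE.
apply: (@measurable_sum _ _ R setT 'I_n) => j.
by apply: measurable_funM => //; exact: measurable_coord.
Qed.

Lemma measurable_addr n (a : 'rV[R]_n) :
  measurable_fun setT (fun x : 'rV[R]_n => (x + a)%R).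
Proof.
apply: measurable_fun_rV => i; under eq_fun do rewrite mxE.
by apply: measurable_funD => //; exact: measurable_coord.
Qed.

Lemma lebesgue_measure_affine (a b : R) (B : set (measurableTypeR R)) :
  a != 0%R -> measurable B ->
  lambda B = `|a|%:E * lambda [set t | B (a * t + b)%R].
Proof.
move=> a0 mB; pose f (t : measurableTypeR R) : measurableTypeR R := (a * t + b)%R.
have mf : measurable_fun setT f.
  by apply: measurable_funD => //; exact: measurable_funM.
pose mu := @measure_function_pushforward__canonical__measure_function_Measure
  _ _ _ _ R lambda f mf.
have := @lebesgue_measure_unique R (mscale (NngNum (normr_ge0 a)) mu).
move=> -> // _ [[x y]] _ <-.
rewrite -[RHS]/(`|a|%:E * lambda [set t | [set` `]x, y]] (f t)]).
have aP : (0 < a)%R \/ (a < 0)%R by apply/orP; rewrite orbC -neq_lt.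
have [ap|an] := aP.
  rewrite (_ : [set t | [set` `]x, y]] (f t)] = [set` `]((x - b) / a)%R, ((y - b) / a)%R]]); last first.
    apply/seteqP; split => t; rewrite /= !in_itv/=.
      by rewrite ltr_pdivrMr// ler_pdivlMr// /f (mulrC t) ltrBlDr lerBrDr.
    by rewrite ltr_pdivrMr// ler_pdivlMr// /f (mulrC t) ltrBlDr lerBrDr.
  rewrite !lebesgue_measure_itv/= !lte_fin ltr_pM2r ?invr_gt0// ltrD2r.
  case: ifPn => _; last by rewrite mule0.
  by rewrite -!EFinB -EFinM gtr0_norm//; congr (_%:E); field.
rewrite (_ : [set t | [set` `]x, y]] (f t)] = [set` `[((y - b) / a)%R, ((x - b) / a)%R[]); last first.
  apply/seteqP; split => t; rewrite /= !in_itv/=.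
    by rewrite ltr_ndivlMr// ler_ndivrMr// /f (mulrC t) ltrBlDr lerBrDr andbC.
  by rewrite ltr_ndivlMr// ler_ndivrMr// /f (mulrC t) ltrBlDr lerBrDr andbC.
rewrite !lebesgue_measure_itv/= !lte_fin ltr_nM2r ?invr_lt0// ltrD2r.
case: ifPn => _; last by rewrite mule0.
by rewrite -!EFinB -EFinM ltr0_norm//; congr (_%:E); field.
Qed.

Lemma lebesgue_measure_shift (b : R) (B : set (measurableTypeR R)) :
  measurable B -> lambda [set t | B (t + b)%R] = lambda B.
Proof.
move=> mB; rewrite [RHS](@lebesgue_measure_affine 1 b)// normr1 mul1e.
by congr (lambda _); apply/seteqP; split => t /=; rewrite mul1r.
Qed.

(** A map that fixes the first coordinate acts on each slice separately, so a
common scaling factor on the slices is the scaling factor on the whole space.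
Translations and elementary matrices are composed of such maps and of maps that
fix the remaining coordinates. *)
Lemma leb_map_rest n (phi : 'rV[R]_n.+1 -> 'rV[R]_n.+1)
    (psi : R -> 'rV[R]_n -> 'rV[R]_n) (c : R) (B : set 'rV[R]_n.+1) :
  (0 <= c)%R -> measurable_fun setT phi ->
  (forall t y, phi (rV_cons (t, y)) = rV_cons (t, psi t y)) ->
  (forall t C, measurable C -> leb n C = c%:E * leb n [set y | C (psi t y)]) ->
  measurable B -> leb n.+1 B = c%:E * leb n.+1 [set x | B (phi x)].
Proof.
move=> c0 mphi phiE psiE mB; have mB' := measurable_preimage mphi mB.
rewrite !leb_slice_rest// -ge0_integralZl_EFin//; last exact: measurable_leb_slice.
apply: eq_integral => t _; rewrite (psiE t); last exact: measurable_cons_rest.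
by congr (_ * leb n _); apply/seteqP; split => y /=; rewrite phiE.
Qed.

Lemma leb_map_head n (phi : 'rV[R]_n.+1 -> 'rV[R]_n.+1)
    (psi : 'rV[R]_n -> R -> R) (c : R) (B : set 'rV[R]_n.+1) :
  (0 <= c)%R -> measurable_fun setT phi ->
  (forall t y, phi (rV_cons (t, y)) = rV_cons (psi y t, y)) ->
  (forall y (C : set (measurableTypeR R)), measurable C ->
     lambda C = c%:E * lambda [set t | C (psi y t)]) ->
  measurable B -> leb n.+1 B = c%:E * leb n.+1 [set x | B (phi x)].
Proof.
move=> c0 mphi phiE psiE mB; have mB' := measurable_preimage mphi mB.
rewrite !leb_slice_head// -ge0_integralZl_EFin//; last exact: measurable_head_slice.
apply: eq_integral => y _; rewrite (psiE y); last exact: measurable_cons_head.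
by congr (_ * lambda _); apply/seteqP; split => t /=; rewrite phiE.
Qed.

Lemma add_rV_cons n (s t : R) (x y : 'rV[R]_n) :
  (rV_cons (s, x) + rV_cons (t, y) = rV_cons (s + t, x + y))%R.
Proof.
rewrite /rV_cons [LHS](@add_row_mx _ 1 1 n)/=.
have -> : (const_mx s + const_mx t = const_mx (s + t) :> 'rV[R]_1)%R.
  by apply/matrixP => i j; rewrite !mxE.
by [].
Qed.

Lemma leb_shift n (a : 'rV[R]_n) (B : set 'rV[R]_n) : measurable B ->
  leb n [set x | B (x + a)%R] = leb n B.
Proof.
elim: n a B => [|n IH] a B mB.
  by congr (leb 0 _); apply/seteqP; split => x /=; rewrite [(x + a)%R]thinmx0 [x]thinmx0.
rewrite -[a]rV_unconsK; case: (rV_uncons a) => s y.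
(* Translate the two groups of coordinates one after the other. *)
have -> : rV_cons (s, y) = (rV_cons (0%R, y) + rV_cons (s, 0%R))%R.
  by rewrite add_rV_cons add0r addr0.
have H1 := @leb_map_rest n (fun x => x + rV_cons (0, y))%R (fun _ x => x + y)%R 1.
have H2 := @leb_map_head n (fun x => x + rV_cons (s, 0))%R (fun _ t => t + s)%R 1.
have m2 := measurable_preimage (measurable_addr (rV_cons (s, 0%R))) mB.
rewrite [RHS]H2//; first last.
- by move=> _ C mC; rewrite mul1e lebesgue_measure_shift.
- by move=> t x; rewrite add_rV_cons addr0.
- exact: measurable_addr.
rewrite [in RHS]H1//; first last.
- by move=> _ C mC; rewrite mul1e IH.
- by move=> t x; rewrite add_rV_cons addr0.
- exact: measurable_addr.
rewrite !mul1e; congr (leb _ _).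
by apply/seteqP; split => x /=; rewrite addrA.
Qed.

End slicing.

(** * Lebesgue measure under linear maps *)

Section linear_change.
Context {R : realType}.
Local Open Scope ereal_scope.
Notation lambda := (@lebesgue_measure R).

Definition scales_leb n (M : 'M[R]_n) := forall B, measurable B ->
  leb n B = `|\det M|%:E * leb n [set x | B (x *m M)].

Lemma scales_leb_mul n (M N : 'M[R]_n) :
  scales_leb M -> scales_leb N -> scales_leb (M *m N).
Proof.
move=> sM sN B mB; rewrite sN// sM; last first.
  exact: measurable_preimage (measurable_mulmxr N) mB.
rewrite det_mulmx normrM muleA -EFinM mulrC; congr (_ * leb n _).
by apply/seteqP; split => x /=; rewrite mulmxA.
Qed.

Lemma rV_cons_mul_block n (t : R) (y : 'rV[R]_n) a b c d :
  (rV_cons (t, y) *m (block_mx a b c d : 'M[R]_(1 + n)) =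
   rV_cons (t * a 0 0 + (y *m c) 0 0, t *: b + y *m d))%R.
Proof.
rewrite /rV_cons [LHS](@mul_row_block _ _ 1 n 1 n)/=.
have -> : (const_mx t *m a + y *m c = const_mx (t * a 0 0 + (y *m c) 0 0))%R.
  by apply/matrixP => i j; rewrite !(ord1 i, ord1 j) mxE [in LHS]mxE big_ord1 !mxE.
have -> : const_mx t = t%:M :> 'M[R]_1.
  by apply/matrixP => i j; rewrite !(ord1 i, ord1 j) !mxE eqxx.
by rewrite mul_scalar_mx.
Qed.

Lemma scales_leb_head n (a : R) (c : 'cV[R]_n) : a != 0%R ->
  @scales_leb n.+1 (block_mx a%:M 0 c 1%:M : 'M[R]_(1 + n)).
Proof.
move=> a0 B mB.
rewrite (@det_lblock _ 1 n) det_scalar1 det1 mulr1.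
apply: (@leb_map_head _ _ _ (fun y t => a * t + (y *m c) 0 0)%R) => //.
- exact: measurable_mulmxr.
- by move=> t y; rewrite rV_cons_mul_block scaler0 add0r mulmx1 mxE eqxx mulr1n mulrC.
- by move=> y C mC; exact: lebesgue_measure_affine.
Qed.

Lemma scales_leb_rest n (b : 'rV[R]_n) (d : 'M[R]_n) : scales_leb d ->
  @scales_leb n.+1 (block_mx 1%:M b 0 d : 'M[R]_(1 + n)).
Proof.
move=> sd B mB.
rewrite (@det_ublock _ 1 n) det1 mul1r.
apply: (@leb_map_rest _ _ _ (fun t y => t *: b + y *m d)%R) => //.
- exact: measurable_mulmxr.
- by move=> t y; rewrite rV_cons_mul_block mulmx0 !mxE eqxx mulr1 addr0.
- move=> t C mC; rewrite -(leb_shift (t *: b)%R mC) sd; last first.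
    exact: measurable_preimage (measurable_addr _) mC.
  by congr (_ * leb n _); apply/seteqP; split => x /=; rewrite addrC.
Qed.

(** Gaussian elimination: the Schur complement splits off the first coordinate,
once a shear has made the top left entry nonzero. *)
Lemma leb_mulmx n (M : 'M[R]_n) : M \in unitmx -> scales_leb M.
Proof.
elim: n M => [M _ B mB|n IH].
  rewrite det_mx00 normr1 mul1e; congr (leb 0 _).
  by apply/seteqP; split => x /=; rewrite [(x *m M)%R]thinmx0 [x]thinmx0.
have pivot (M : 'M[R]_(1 + n)) : M \in unitmx -> M 0%R 0%R != 0%R -> @scales_leb n.+1 M.
  move=> uM; set a := M 0%R 0%R => a0.
  pose b := ursubmx M; pose c := dlsubmx M; pose d := drsubmx M.
  pose d' := (d - a^-1 *: (c *m b))%R.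
  have ME : M = (block_mx a%:M 0 c 1%:M *m block_mx 1%:M (a^-1 *: b) 0 d')%R.
    rewrite mulmx_block !(mul1mx, mulmx1, mul0mx, mulmx0, addr0, add0r).
    rewrite mul_scalar_mx scalerA mulfV// scale1r.
    rewrite -scalemxAr /d' addrC subrK -{1}(submxK M); congr block_mx.
    apply/matrixP => i j; rewrite (ord1 i) (ord1 j) !mxE eqxx mulr1n.
    by congr (M _ _); exact/val_inj.
  rewrite ME; apply: scales_leb_mul; first exact: scales_leb_head.
  apply: scales_leb_rest; apply: IH; rewrite unitmxE unitfE.
  move: uM; rewrite unitmxE unitfE {1}ME det_mulmx (@det_ublock _ 1 n).
  by rewrite !mulf_eq0 !negb_or => /andP[_ /andP[]].
suff step (M : 'M[R]_(1 + n)) : M \in unitmx -> @scales_leb n.+1 M by exact: step.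
move=> uM; pose b := ursubmx M.
have [M00|M00] := eqVneq (M 0%R 0%R) 0%R; last exact: pivot.
pose N (e : 'cV[R]_n) : 'M[R]_(1 + n) := block_mx 1%:M 0 e 1%:M.
have sN e : @scales_leb n.+1 (N e) by exact: scales_leb_head.
have NN : (N b^T *m N (- b^T) = 1%:M)%R.
  rewrite /N mulmx_block !(mul1mx, mulmx1, mul0mx, mulmx0, addr0, add0r) subrr.
  by rewrite -scalar_mx_block.
(* The shear by [b^T] puts [b b^T > 0] into the top left corner. *)
have -> : (M = (M *m N b^T) *m N (- b^T))%R by rewrite -mulmxA NN mulmx1.
apply: scales_leb_mul => //; apply: pivot.
  by rewrite unitmx_mul uM/= unitmxE unitfE (@det_lblock _ 1 n) !det1 mulr1 oner_neq0.
have z0 : 0%R = lshift n 0%R :> 'I_(1 + n) by exact/val_inj.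
have -> : (M *m N b^T)%R 0%R 0%R = dotv b b.
  rewrite [in LHS]z0 -{1}(submxK M) /N mulmx_block block_mxEul mulmx1 mxE dotvE.
  by rewrite /ulsubmx !mxE -z0 M00 add0r.
apply: contraTneq uM => /dotv_eq0/rowP b0; rewrite unitmxE unitfE negbK.
rewrite (expand_det_row _ 0%R) big1// => j _.
suff -> : M 0%R j = 0%R by rewrite mul0r.
case: (@split_ordP 1 n j) => k ->; first by rewrite (ord1 k) -z0.
by move: (b0 k); rewrite !mxE -z0.
Qed.

End linear_change.

(** * Borel sets, compact sets and balls *)

Section borel.
Context {R : realType} {n : nat}.
Implicit Types (A B : set 'rV[R]_n) (x y : 'rV[R]_n).

(** The norm is the sup norm, so balls are products of intervals. *)
Lemma ball_measurable x (e : R) : 0 < e -> measurable (ball x e : set 'rV[R]_n).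
Proof.
move=> e0; rewrite (_ : ball x e =
    \bigcap_(i in [set: 'I_n]) [set y | ball (x 0 i) e (y 0 i)]); last first.
  apply/seteqP; split => y /=; first by move=> [_ xy] i _; exact: xy.
  by move=> xy; split => // i j; rewrite (ord1 i); exact: xy.
apply: fin_bigcap_measurable => // i _.
apply: (measurable_preimage (B := ball (x 0 i) e) (measurable_coord i)).
exact: measurable_ball.
Qed.

(** The neighbourhoods of radius [1 / (k + 1)] formed by finitely many balls are
measurable and shrink to the closure. *)
Lemma compact_rV_measurable A : compact A -> measurable A.
Proof.
move=> cA; have eps_net (k : nat) : exists U : set 'rV[R]_n, [/\ measurable U, A `<=` U &
    forall y, U y -> exists2 x, A x & ball x k.+1%:R^-1 y].
  have k0 : 0 < k.+1%:R^-1 :> R by rewrite invr_gt0 ltr0n.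
  move: (cA); rewrite compact_cover => /(_ _ A (fun x => ball x k.+1%:R^-1)).
  case=> [x _|x Ax|D DA AD]; first exact: ball_open.
    by exists x => //; exact: ballxx.
  exists (\bigcup_(i in [set` D]) ball i k.+1%:R^-1); split => //.
    by apply: fin_bigcup_measurable => // i _; exact: ball_measurable.
  by move=> y [x Dx xy]; exists x => //; exact/set_mem/DA.
pose U k := sval (cid (eps_net k)).
have UP k := svalP (cid (eps_net k)).
suff -> : A = \bigcap_k U k by apply: bigcap_measurable => // k _; case: (UP k).
apply/seteqP; split => [x Ax k _|y Uy]; first by case: (UP k) => _ /(_ x Ax).
have clA : closed A by apply: compact_closed => //; exact: norm_hausdorff.
apply: clA => V /nbhs_ballP[e /= e0 eV].
pose k := Num.trunc e^-1.
have ke : k.+1%:R^-1 <= e.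
  by rewrite invf_ple ?posrE ?ltr0n// ltW// truncnS_gt// invr_ge0 ltW.
have [_ _ /(_ y (Uy k Logic.I))[x Ax xy]] := UP k.
by exists x; split => //; apply: eV; apply/ball_sym; exact: le_ball xy.
Qed.

Lemma closed_rV_measurable A : closed A -> measurable A.
Proof.
move=> clA; rewrite (_ : A = \bigcup_k (A `&` [set x | `|x| <= k%:R])); last first.
  apply/seteqP; split => [x Ax|x [k _ []]//].
  by exists (Num.trunc `|x|).+1 => //; split => //=; rewrite ltW// truncnS_gt.
apply: bigcup_measurable => k _; apply: compact_rV_measurable.
apply: bounded_closed_compact.
  exists k%:R; split; first exact: realn.
  by move=> M kM x [_ /= xk]; rewrite (le_trans xk)// ltW.
apply: closedI => //.
apply: (@preimage_closed _ _ (fun x : 'rV[R]_n => `|x|) [set t | t <= k%:R]).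
  by move=> x _; exact: norm_continuous.
exact: closed_le.
Qed.

Lemma continuous_rV_measurable (f : 'rV[R]_n -> R) :
  continuous f -> measurable_fun setT (f : 'rV[R]_n -> measurableTypeR R).
Proof.
move=> cf; apply: (measurability _ (RGenOpens.measurableE R)) => _ [_ [a [b ->]] <-].
rewrite setTI -[X in measurable X]setCK; apply: measurableC.
apply: closed_rV_measurable; apply: open_closedC.
by apply: open_comp => [x _|]; [exact: cf|exact: interval_open].
Qed.

Lemma continuous_dotv (f g : 'rV[R]_n -> 'rV[R]_n) : continuous f -> continuous g ->
  continuous (fun x => dotv (f x) (g x)).
Proof.
move=> cf cg; apply: continuous_big => [|i _ x]; first exact: add_continuous.
have coordf (h : 'rV[R]_n -> 'rV[R]_n) : continuous h -> continuous (fun x => h x 0 i).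
  move=> ch z; apply: (@continuous_comp _ _ _ h (fun y : 'rV[R]_n => y 0 i)); first exact: ch.
  exact: coord_continuous.
exact: (cvgM (coordf f cf x) (coordf g cg x)).
Qed.

Lemma closed_eball x (r : R) : 0 <= r -> closed (eball x r).
Proof.
move=> r0; rewrite (_ : eball x r = [set y | dotv (y - x) (y - x) <= r ^+ 2]).
  apply: (@preimage_closed _ _ (fun y => dotv (y - x) (y - x)) [set t | t <= r ^+ 2]).
    have cB : continuous (fun y : 'rV[R]_n => y - x).
      by move=> z; apply: (@continuousB _ _ _ (fun y : 'rV[R]_n => y) (fun=> x)); [exact: cvg_id|exact: (@cst_continuous _ _ x z)].
    by move=> y _; exact: continuous_dotv.
  exact: closed_le.
by apply/seteqP; split => y; rewrite /eball/= enorm_le.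
Qed.

Lemma eball_bounded x (r : R) : exists M, forall y, eball x r y -> `|y| <= M.
Proof.
exists (r + `|x|) => y yr; rewrite -(subrK x y) (le_trans (ler_normD _ _))//.
by rewrite lerD2r (le_trans (mx_norm_le_enorm _)).
Qed.

Lemma compact_eball x (r : R) : 0 <= r -> compact (eball x r).
Proof.
move=> r0; apply: bounded_closed_compact; last exact: closed_eball.
have [M yM] := eball_bounded x r.
exists M; split; first exact: num_real.
by move=> N MN y /yM yr /=; rewrite (le_trans yr)// ltW.
Qed.

Lemma measurable_eball x (r : R) : 0 <= r -> measurable (eball x r).
Proof. by move=> r0; apply: compact_rV_measurable; exact: compact_eball. Qed.

End borel.

Section coordinates.
Context {R : realType} {n : nat}.
Implicit Types (s t : R) (x y : 'rV[R]_n).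

Lemma rV_cons_head t y : rV_cons (t, y) 0 0 = t.
Proof. by have [] := rV_consK (t, y). Qed.

Lemma rV_cons_rest t y i : rV_cons (t, y) 0 (lift 0 i) = y 0 i.
Proof.
rewrite (_ : lift 0 i = rshift 1 i); last exact/val_inj.
by rewrite /rV_cons (@row_mxEr _ 1 1 n).
Qed.

Lemma dotv_rV_cons s t x y :
  dotv (rV_cons (s, x)) (rV_cons (t, y)) = s * t + dotv x y.
Proof.
rewrite /dotv big_ord_recl !rV_cons_head; congr (_ + _).
by apply: eq_bigr => i _; rewrite !rV_cons_rest.
Qed.

Lemma scale_rV_cons a t y : a *: rV_cons (t, y) = rV_cons (a * t, a *: y).
Proof.
apply/rowP => i; rewrite mxE; case: (unliftP 0 i) => [j|] ->.
  by rewrite !rV_cons_rest mxE.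
by rewrite !rV_cons_head.
Qed.

End coordinates.

Section volumes.
Context {R : realType}.
Local Open Scope ereal_scope.
Notation lambda := (@lebesgue_measure R).

Lemma measurable_cube n (M : R) : measurable [set x : 'rV[R]_n | forall i, (`|x 0 i| <= M)%R].
Proof.
have -> : [set x : 'rV[R]_n | forall i, (`|x 0 i| <= M)%R] =
    \bigcap_(i in [set: 'I_n]) [set x | (`|x 0 i| <= M)%R].
  by apply/seteqP; split => x /= xM; [move=> i _; exact: xM|move=> i; exact: xM].
apply: fin_bigcap_measurable => // i _.
have mB : measurable ([set t | (`|t| <= M)%R] : set (measurableTypeR R)).
  have -> : [set t | (`|t| <= M)%R] = [set` `[(- M)%R, M]].
    by apply/seteqP; split => t; rewrite /= in_itv/= ler_norml.
  exact: measurable_itv.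
exact: (measurable_preimage (measurable_coord i) mB).
Qed.

Lemma leb_cube_lty n (M : R) : leb n [set x : 'rV[R]_n | forall i, (`|x 0 i| <= M)%R] < +oo.
Proof.
elim: n => [|n IH]; first by rewrite /= diracE ltry.
rewrite (_ : leb _ _ = lambda `[(- M)%R, M] *
    leb n [set x : 'rV[R]_n | forall i, (`|x 0 i| <= M)%R]).
  by rewrite lte_mul_pinfty// ?ge0_fin_numE// lebesgue_measure_itv/=; case: ifPn; rewrite // -EFinB ltry.
rewrite -product_measure1E//; last exact: measurable_cube.
congr ((lambda \x leb n) _); apply/seteqP; split => -[t y] /=.
  move=> tyM; split; first by have := tyM 0%R; rewrite rV_cons_head in_itv/= ler_norml.
  by move=> i; have := tyM (lift 0%R i); rewrite rV_cons_rest.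
rewrite in_itv/= -ler_norml => -[tM yM] i.
by case: (unliftP 0%R i) => [j|] ->; rewrite ?rV_cons_rest ?rV_cons_head.
Qed.

Lemma compact_leb_lty n (A : set 'rV[R]_n) : compact A -> leb n A < +oo.
Proof.
move=> cA; have [M [_ AM]] := compact_bounded cA.
apply: le_lt_trans (leb_cube_lty n (M + 1)%R); apply: le_measure.
- by rewrite inE; exact: compact_rV_measurable.
- by rewrite inE; exact: measurable_cube.
- move=> x Ax i /=; apply: le_trans (AM (M + 1)%R _ x Ax); last by rewrite ltrDl.
  by rewrite [leRHS]/Num.Def.normr/= mx_normrE; apply: (le_bigmax _ (fun j => `|x j.1 j.2|%R) (0%R, i)).
Qed.

Lemma leb_set1 n (c : 'rV[R]_n.+1) : leb n.+1 [set c] = 0.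
Proof.
have m1 : measurable [set c] by apply: compact_rV_measurable; exact: compact_set1.
rewrite leb_slice_head//; apply: integral0_eq => y _.
apply/eqP; rewrite eq_le measure_ge0 andbT -(lebesgue_measure_set1 (c 0%R 0%R)).
apply: le_measure; rewrite ?inE.
- exact: measurable_cons_head.
- exact: measurable_set1.
- by move=> t /= <-; rewrite rV_cons_head.
Qed.

(** A dilation and a translation reduce the case [r > 0] to the unit ball.  For
[r = 0] both sides vanish, except in dimension [0], where both are [1]. *)
Lemma leb_eball n (c : 'rV[R]_n) (r : R) : (0 <= r)%R ->
  leb n (eball c r) = (r ^+ n)%:E * unit_ball_volume R n.
Proof.
rewrite le_eqVlt => /predU1P[<-|r0].
  case: n c => [|n] c.
    rewrite expr0 mul1e; congr (leb 0 _); apply/seteqP; split => x _ /=;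
      by rewrite /eball/= [(x - _)%R]thinmx0 enorm_le// /dotv big_ord0 sqr_ge0.
  rewrite expr0n mul0e -[RHS](leb_set1 c); congr (leb _ _).
  apply/seteqP; split => x /=; rewrite /eball/= enorm_le// expr0n/=.
    move=> xc; apply/eqP; rewrite -subr_eq0; apply/eqP/dotv_eq0/le_anti.
    by rewrite xc dotv_ge0.
  by move=> ->; rewrite subrr /dotv big1// => i _; rewrite mxE mul0r.
have mB : measurable (eball c r) by apply: measurable_eball; exact: ltW.
rewrite -(leb_shift c mB) (@leb_mulmx _ _ r%:M); last 2 first.
- by rewrite unitmxE det_scalar unitfE expf_neq0// gt_eqF.
- exact: measurable_preimage (measurable_addr c) mB.
rewrite det_scalar ger0_norm ?exprn_ge0 ?ltW//; congr (_ * leb n _).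
have r0' := ltW r0.
have E x : (enorm (x *m r%:M + c - c) <= r)%R = (enorm (x - 0) <= 1)%R.
  rewrite mul_mx_scalar addrK subr0 !enorm_le// !dotv_lin mulrA -expr2 expr1n.
  by rewrite ger_pMr// exprn_gt0.
by apply/seteqP; split => x; rewrite /eball/= E.
Qed.

Lemma unit_ball_volume_fin_num n : unit_ball_volume R n \is a fin_num.
Proof. by rewrite ge0_fin_numE// compact_leb_lty//; exact: compact_eball. Qed.

End volumes.

(** * Steiner symmetrals of compact sets *)

Section steiner.
Context {R : realType} {n : nat}.
Implicit Types (A B : set 'rV[R]_n) (x y z u w c : 'rV[R]_n).
Notation lambda := (@lebesgue_measure R).

Lemma compact_rV_closed A : compact A -> closed A.
Proof. by apply: compact_closed; exact: norm_hausdorff. Qed.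

Lemma continuous_line x u : continuous (fun t : R => x + t *: u).
Proof.
move=> t; apply: (@continuousD _ _ _ (fun=> x) (fun t : R => t *: u)).
  exact: (@cst_continuous _ _ x t).
exact: scalel_continuous.
Qed.

Lemma continuous_dotvr u : continuous (fun x => dotv x u).
Proof.
apply: continuous_dotv => x; [exact: cvg_id|exact: (@cst_continuous _ _ u x)].
Qed.

Lemma continuous_perp u : continuous (perp u).
Proof.
move=> x; apply: (@continuousB _ _ _ (fun x => x) (fun x => dotv x u *: u)).
  exact: cvg_id.
apply: (@continuous_comp _ _ _ (fun x => dotv x u) (fun t : R => t *: u)).
  exact: continuous_dotvr.
exact: scalel_continuous.
Qed.

Lemma perp_add x u t : dotv u u = 1 -> dotv x u = 0 -> perp u (x + t *: u) = x.
Proof. by move=> u1 xu; rewrite /perp !dotv_lin u1 xu mulr1 add0r addrK. Qed.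

Lemma dotv_line x u t : dotv u u = 1 -> dotv x u = 0 -> dotv (x + t *: u) u = t.
Proof. by move=> u1 xu; rewrite !dotv_lin u1 xu mulr1 add0r. Qed.

Lemma fiber_closed A u x : closed A -> closed (fiber A u x).
Proof.
move=> cA; apply: (@preimage_closed _ _ (fun t : R => x + t *: u) A) => // t _.
exact: continuous_line.
Qed.

Lemma fiber_measurable A u x : compact A ->
  measurable (fiber A u x : set (measurableTypeR R)).
Proof.
by move=> cA; apply: closed_measurable; apply: fiber_closed; exact: compact_rV_closed.
Qed.

Lemma fiber_lty A u x : dotv u u = 1 -> compact A -> (lambda (fiber A u x) < +oo)%E.
Proof.
move=> u1 cA; apply: compact_finite_measure.
have cI : compact ((fun y => dotv (y - x) u) @` A).
  apply: continuous_compact cA; apply: continuous_subspaceT => y.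
  apply: (@continuous_comp _ _ _ (fun y => y - x) (fun y => dotv y u)).
    apply: (@continuousB _ _ _ (fun x => x) (fun=> x)); first exact: cvg_id.
    exact: (@cst_continuous _ _ x y).
  exact: continuous_dotvr.
apply: subclosed_compact cI _.
  by apply: fiber_closed; exact: compact_rV_closed.
move=> t At; exists (x + t *: u) => //.
by rewrite addrC addKr dotvZl u1 mulr1.
Qed.

Lemma fiber_fin_num A u x : dotv u u = 1 -> compact A ->
  lambda (fiber A u x) \is a fin_num.
Proof. by move=> u1 cA; rewrite ge0_fin_numE ?fiber_lty ?measure_ge0. Qed.

Lemma steinerP A u x t : dotv u u = 1 -> dotv x u = 0 ->
  steiner u A (x + t *: u) <-> (fiber A u x !=set0 /\
    (`|t|%:E <= (2^-1)%:E * lambda (fiber A u x))%E).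
Proof.
move=> u1 xu; split=> [[x' [t' [x'u eqy ne le]]]|[ne le]]; last by exists x, t.
have <- : x' = x by rewrite -(perp_add t' u1 x'u) -eqy perp_add.
by have <- : t' = t by rewrite -(dotv_line t' u1 x'u) -eqy dotv_line.
Qed.

Lemma image_perpP A u x : dotv u u = 1 -> dotv x u = 0 ->
  (perp u @` A) x <-> fiber A u x !=set0.
Proof.
move=> u1 xu; split=> [[a Aa <-]|[t At]].
  by exists (dotv a u); rewrite /fiber/= perpK.
by exists (x + t *: u) => //; rewrite perp_add.
Qed.

Lemma dotv_add_perp x u t : dotv u u = 1 -> dotv x u = 0 ->
  dotv (x + t *: u) (x + t *: u) = dotv x x + t ^+ 2.
Proof. by move=> u1 xu; rewrite !dotv_lin (dotvC u x) xu u1; ring. Qed.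

(** On the line through a point at distance [d] from the projected center, the
ball cuts out an interval of half length [sqrt (r ^ 2 - d ^ 2)]; the fiber of
[A] is not longer, and centering it keeps it inside the projected ball. *)
Lemma steiner_eball A u c r : dotv u u = 1 -> compact A -> 0 <= r ->
  A `<=` eball c r -> steiner u A `<=` eball (perp u c) r.
Proof.
move=> u1 cA r0 Ac y; rewrite -[y in steiner u A y](perpK u).
rewrite steinerP ?dotv_perp// => -[[s0 As0] le].
set x := perp u y in As0 le; set t := dotv y u in le.
pose d := dotv (x - perp u c) (x - perp u c).
have xc_perp : dotv (x - perp u c) u = 0 by rewrite dotvDl dotvNl !dotv_perp// subrr.
have sphere s : fiber A u x s -> (s - dotv c u) ^+ 2 <= r ^+ 2 - d.
  move=> /Ac; rewrite /eball/= enorm_le// lerBrDl -(dotv_add_perp _ u1 xc_perp).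
  rewrite (_ : x - perp u c + _ = x + s *: u - c)//.
  by apply/rowP => i; rewrite /perp !mxE; ring.
have dr : 0 <= r ^+ 2 - d by rewrite (le_trans _ (sphere _ As0)) ?sqr_ge0.
pose l := Num.sqrt (r ^+ 2 - d).
have tl : `|t| <= l.
  rewrite -lee_fin (le_trans le)//.
  have /le_trans -> // : ((2^-1)%:E * lambda (fiber A u x) <=
      (2^-1)%:E * lambda [set` `[(dotv c u - l)%R, (dotv c u + l)%R]])%E.
    rewrite lee_pmul2l//; apply: le_measure; rewrite ?inE.
    - exact: fiber_measurable.
    - exact: measurable_itv.
    move=> s /sphere; rewrite -ler_sqrt// sqrtr_sqr -/l ler_norml /= in_itv/=.
    by move=> /andP[? ?]; apply/andP; split; lra.
  have l0 : 0 <= l by exact: sqrtr_ge0.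
  rewrite lebesgue_measure_itv/= lte_fin; case: ifPn => _; last by rewrite mule0.
  by rewrite -EFinB -EFinM lee_fin; lra.
rewrite /eball/= enorm_le// (_ : y - _ = (x - perp u c) + t *: u); last first.
  by rewrite addrAC perpK.
rewrite dotv_add_perp// -/d -lerBrDl -(sqr_sqrtr dr) -/l.
by rewrite -[t ^+ 2]real_normK ?num_real// ler_sqr ?nnegrE ?sqrtr_ge0.
Qed.

Lemma compact_sub_eball A : compact A -> exists2 r, 0 <= r & A `<=` eball 0 r.
Proof.
move=> cA; have cI : compact ((fun y => dotv y y) @` A).
  apply: continuous_compact cA; apply: continuous_subspaceT.
  by apply: continuous_dotv => x; exact: cvg_id.
have [M [_ AM]] := compact_bounded cI.
pose e := Num.sqrt (`|M| + 1); exists e => [|x Ax]; first exact: sqrtr_ge0.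
rewrite /eball/= subr0 enorm_le ?sqrtr_ge0// sqr_sqrtr ?addr_ge0//.
rewrite -[leLHS]ger0_norm ?dotv_ge0//; apply: AM; last by exists x.
by rewrite (le_lt_trans (ler_norm _))// ltrDl.
Qed.

(** The length of the fibers is upper semicontinuous: an open set of length
close to that of one fiber contains all neighbouring fibers. So the
symmetral is cut out by closed conditions, one for each open set [U] of length
at most [c]: either the fiber leaves [U], or the height is at most [c / 2]. *)
Lemma steiner_compact A u : dotv u u = 1 -> compact A -> compact (steiner u A).
Proof.
move=> u1 cA; have clA := compact_rV_closed cA.
pose cut (p : set R * R) := (perp u @^-1` (perp u @` (A `&` [set a | ~ p.1 (dotv a u)])))
  `|` [set y | `|dotv y u| <= p.2 / 2].
pose cuts := [set p : set R * R | open p.1 /\ (lambda p.1 <= p.2%:E)%E].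
have SE : steiner u A = (perp u @^-1` (perp u @` A)) `&` \bigcap_(p in cuts) cut p.
  apply/seteqP; split => y; rewrite -[y in steiner u A y](perpK u) steinerP ?dotv_perp//.
    move=> [ne le]; split; first by apply/(image_perpP _ u1 (dotv_perp _ u1)).
    move=> -[U e] [/= oU Ue]; have [AU|] := pselect (fiber A u (perp u y) `<=` U).
      right => /=; rewrite -lee_fin (le_trans le)// mulrC EFinM.
      rewrite lee_pmul2l// (le_trans _ Ue)//; apply: le_measure; rewrite ?inE//.
        exact: fiber_measurable.
      exact: open_measurable.
    move=> /existsNP[t /not_implyP[At nUt]]; left => /=.
    exists (perp u y + t *: u); last by rewrite perp_add ?dotv_perp.
    by split => //=; rewrite dotv_line ?dotv_perp.
  move=> [/(image_perpP _ u1 (dotv_perp _ u1)) ne cuty]; split => //.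
  have Lfin := fiber_fin_num (perp u y) u1 cA.
  rewrite -(fineK Lfin) -EFinM lee_fin; set L := fine _.
  apply/ler_addgt0Pr => e e0.
  have [|U [oU AU Ue]] := @lebesgue_regularity_outer R _ e
    (fiber_measurable u (perp u y) cA) (fiber_lty (perp u y) u1 cA).
    exact: e0.
  have Uc : cuts (U, L + e).
    split => //=; rewrite EFinD /L fineK// -{1}(setDKU AU).
    rewrite (le_trans (measureU2 _ _ _))//.
    - by apply: measurableD; [exact: open_measurable|exact: fiber_measurable].
    - exact: fiber_measurable.
    - by rewrite [leRHS]addeC leeD2r// ltW.
  have [[a [Aa /= nUa] ay]|/= le] := cuty _ Uc.
    exfalso; apply: nUa; apply: AU; rewrite /fiber/= -ay.
    by rewrite perpK.
  rewrite (le_trans le)// mulrDl mulrC lerD2l ler_pdivrMr// ler_peMr ?ltW//.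
  by rewrite ltr1n.
have clP B : compact B -> closed (perp u @^-1` (perp u @` B)).
  move=> cB; apply: preimage_closed; first by move=> y _; exact: continuous_perp.
  apply: compact_rV_closed.
  by apply: continuous_compact cB; apply: continuous_subspaceT; exact: continuous_perp.
have clS : closed (steiner u A).
  rewrite SE; apply: closedI; first exact: clP.
  apply: closed_bigI => -[U e] [/= oU _]; apply: closedU.
    apply: clP; apply: compact_closedI => //.
    apply: (@preimage_closed _ _ (fun a => dotv a u) (~` U)).
      by move=> y _; exact: continuous_dotvr.
    exact: open_closedC.
  apply: (@preimage_closed _ _ (fun y => `|dotv y u|) [set t | t <= e / 2]).
    move=> y _; apply: (@continuous_comp _ _ _ (fun a => dotv a u) Num.norm).
      exact: continuous_dotvr.
    exact: norm_continuous.
  exact: closed_le.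
have [r r0 Ar] := compact_sub_eball cA.
apply: (subclosed_compact clS (compact_eball (x := perp u 0) r0)).
exact: steiner_eball.
Qed.

Lemma steiner_fiber_itv A u x : dotv u u = 1 -> compact A -> dotv x u = 0 ->
  fiber A u x !=set0 ->
  let a := fine (lambda (fiber A u x)) / 2 in
  fiber (steiner u A) u x = `[- a, a]%classic.
Proof.
move=> u1 cA xu ne a; have Lfin := fiber_fin_num x u1 cA.
have E t : (`|t|%:E <= (2^-1)%:E * lambda (fiber A u x))%E = (t \in `[- a, a]).
  by rewrite in_itv/= -ler_norml -(fineK Lfin) -EFinM lee_fin mulrC.
apply/seteqP; split => t; first by rewrite /fiber/= steinerP// E => -[].
by move=> tL; rewrite /fiber/= steinerP// E.
Qed.

Lemma steiner_fiber0 A u x : dotv u u = 1 -> dotv x u = 0 ->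
  ~ (fiber A u x !=set0) -> fiber (steiner u A) u x = set0.
Proof.
move=> u1 xu e; apply/seteqP; split => t //.
by rewrite /fiber/= steinerP// => -[].
Qed.

Lemma steiner_fiber_measure A u x : dotv u u = 1 -> compact A -> dotv x u = 0 ->
  lambda (fiber (steiner u A) u x) = lambda (fiber A u x).
Proof.
move=> u1 cA xu; have [ne|e] := pselect (fiber A u x !=set0); last first.
  by rewrite steiner_fiber0//; move/set0P/negP/negPn/eqP : e => ->.
rewrite steiner_fiber_itv// -[RHS]fineK ?fiber_fin_num//.
have : 0 <= fine (lambda (fiber A u x)) by apply: fine_ge0; exact: measure_ge0.
rewrite lebesgue_measure_itv/= lte_fin; case: ifPn => [_ _|].
  by rewrite -EFinB; congr (_%:E); lra.
by rewrite -leNgt => h L0; congr (_%:E); lra.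
Qed.

End steiner.

(** * Loss of volume under translation *)

Section slicing_along.
Context {R : realType} {n : nat}.
Variables (u : 'rV[R]_n.+1) (Q : 'M[R]_n.+1).
Hypotheses (QQ : Q *m Q^T = 1%:M) (Qu : row 0 Q = u).
Notation lambda := (@lebesgue_measure R).

(** The isometry onto the hyperplane orthogonal to [u] given by the other rows
of [Q]. *)
Definition hyperplane (y : 'rV[R]_n) : 'rV[R]_n.+1 := rV_cons (0, y) *m Q.

Lemma frame_first : rV_cons (1, 0) *m Q = u.
Proof.
rewrite -Qu rowE; congr (_ *m _); apply/rowP => i.
case: (unliftP 0 i) => [j|] ->; first by rewrite rV_cons_rest !mxE.
by rewrite rV_cons_head mxE !eqxx.
Qed.

Lemma frame_cons t y : rV_cons (t, y) *m Q = hyperplane y + t *: u.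
Proof.
rewrite -frame_first scalemxAl -mulmxDl; congr (_ *m _).
by rewrite scale_rV_cons add_rV_cons add0r mulr1 scaler0 addr0.
Qed.

Lemma frame_unit : dotv u u = 1.
Proof. by rewrite -frame_first dotv_isometry// dotv_rV_cons mulr1 /dotv big1 ?addr0// => i _; rewrite mxE mul0r. Qed.

Lemma dotv_hyperplane y : dotv (hyperplane y) u = 0.
Proof.
rewrite -frame_first dotv_isometry// dotv_rV_cons mul0r /dotv big1 ?addr0// => i _.
by rewrite mxE mulr0.
Qed.

Lemma hyperplane_isometry x y :
  dotv (hyperplane x - hyperplane y) (hyperplane x - hyperplane y) = dotv (x - y) (x - y).
Proof.
rewrite -mulmxBl dotv_isometry// -scaleN1r scale_rV_cons add_rV_cons dotv_rV_cons.
by rewrite mulr0 addr0 mulr0 add0r scaleN1r.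
Qed.

Lemma perp_hyperplane z : exists y, perp u z = hyperplane y.
Proof.
have QQ' : Q^T *m Q = 1%:M by exact: mulmx1C.
rewrite -[z]mulmx1 -QQ' mulmxA -[z *m _]rV_unconsK; case: (rV_uncons _) => t y.
by exists y; rewrite frame_cons perp_add ?frame_unit ?dotv_hyperplane.
Qed.

Lemma leb_fibers (B : set 'rV[R]_n.+1) : measurable B ->
  (leb n.+1 B = \int[leb n]_y lambda (fiber B u (hyperplane y)))%E.
Proof.
move=> mB; have uQ : Q \in unitmx by apply: (mulmx1_unit QQ).1.
rewrite (leb_mulmx uQ)// orthogonal_det// mul1e leb_slice_head; last first.
  exact: measurable_preimage (measurable_mulmxr Q) mB.
apply: eq_integral => y _; congr (lambda _).
by apply/seteqP; split => t /=; rewrite /fiber/= frame_cons.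
Qed.

Lemma measurable_fibers (B : set 'rV[R]_n.+1) : measurable B ->
  measurable_fun setT (fun y => lambda (fiber B u (hyperplane y))).
Proof.
move=> mB; have := measurable_head_slice (measurable_preimage (measurable_mulmxr Q) mB).
apply: eq_measurable_fun => y _; congr (lambda _).
by apply/seteqP; split => t /=; rewrite /fiber/= frame_cons.
Qed.

Lemma le_leb_fibers (B C : set 'rV[R]_n.+1) : measurable B -> measurable C ->
  (forall x, dotv x u = 0 -> (lambda (fiber B u x) <= lambda (fiber C u x))%E) ->
  (leb n.+1 B <= leb n.+1 C)%E.
Proof.
move=> mB mC BC; rewrite !leb_fibers//; apply: ge0_le_integral => //.
- exact: measurable_fibers.
- exact: measurable_fibers.
- by move=> y _; apply: BC; exact: dotv_hyperplane.
Qed.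

End slicing_along.

Section translation_loss.
Context {R : realType}.
Notation lambda := (@lebesgue_measure R).

Definition shifted n (A : set 'rV[R]_n) (a : 'rV[R]_n) := [set x | A (x - a)].

(** For sets of finite measure the best constant [K] is half the total variation
of the derivative of the indicator of [A] in the direction [w]. *)
Definition translation_loss_le n (A : set 'rV[R]_n) (w : 'rV[R]_n) (K : R) :=
  forall h : R, (leb n A <= leb n (A `&` shifted A (h *: w)) + (K * `|h|)%:E)%E.

Lemma compact_shifted n (A : set 'rV[R]_n) a : compact A -> compact (shifted A a).
Proof.
move=> cA; rewrite (_ : shifted A a = (fun x => x + a) @` A).
  apply: continuous_compact cA; apply: continuous_subspaceT => x.
  by apply: (@continuousD _ _ _ (fun x => x) (fun=> a)); [exact: cvg_id|exact: (@cst_continuous _ _ a x)].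
apply/seteqP; split => [x Ax|_ [x Ax <-]]; last by rewrite /shifted/= addrK.
by exists (x - a) => //; rewrite subrK.
Qed.

Lemma compactI_rV n (A B : set 'rV[R]_n) : compact A -> compact B -> compact (A `&` B).
Proof. by move=> cA cB; apply: compact_closedI => //; exact: compact_rV_closed. Qed.

Lemma fiberI n (A B : set 'rV[R]_n) u x : fiber (A `&` B) u x = fiber A u x `&` fiber B u x.
Proof. by []. Qed.

Lemma fiber_shifted n (A : set 'rV[R]_n) u x a s :
  fiber (shifted A (a + s *: u)) u x = [set t | fiber A u (x - a) (t - s)].
Proof.
by apply/seteqP; split => t; rewrite /fiber/shifted/= scalerBl opprD addrACA addrA.
Qed.

Lemma leb_steiner n (A : set 'rV[R]_n.+1) u : dotv u u = 1 -> compact A ->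
  leb n.+1 (steiner u A) = leb n.+1 A.
Proof.
move=> u1 cA; have [Q QQ Qu] := orthogonal_extension u1.
have cS := steiner_compact u1 cA.
rewrite !(leb_fibers QQ Qu); [|exact: compact_rV_measurable..].
apply: eq_integral => y _; apply: steiner_fiber_measure => //.
exact: dotv_hyperplane.
Qed.

(** On each line the two fibers of the symmetral are centered intervals, so the
shorter one is contained in the other, while two fibers of [A] meet in at most
the length of the shorter one, wherever they are placed. The component of [w]
along [u] only moves the fibers of [A] along their line. *)
Lemma steiner_overlap n (A : set 'rV[R]_n.+1) u w : dotv u u = 1 -> compact A ->
  (leb n.+1 (A `&` shifted A w) <=
   leb n.+1 (steiner u A `&` shifted (steiner u A) (perp u w)))%E.
Proof.
move=> u1 cA; have [Q QQ Qu] := orthogonal_extension u1.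
have cS := steiner_compact u1 cA.
have cI (B : set 'rV[R]_n.+1) a : compact B -> measurable (B `&` shifted B a).
  by move=> cB; apply: compact_rV_measurable; apply: compactI_rV => //; exact: compact_shifted.
apply: (le_leb_fibers QQ Qu); [exact: cI|exact: cI|move=> x xu].
set w' := perp u w; have x'u : dotv (x - w') u = 0.
  by rewrite dotvDl dotvNl xu dotv_perp// subrr.
pose s := dotv w u.
have fA : fiber (A `&` shifted A w) u x =
    fiber A u x `&` [set t | fiber A u (x - w') (t - s)].
  by rewrite fiberI -fiber_shifted perpK.
have fS : fiber (steiner u A `&` shifted (steiner u A) w') u x =
    fiber (steiner u A) u x `&` fiber (steiner u A) u (x - w').
  rewrite fiberI -[w' in shifted _ w']addr0 -(scale0r u) fiber_shifted; congr (_ `&` _).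
  by apply/seteqP; split => t /=; rewrite subr0.
have m1 x0 := fiber_measurable u x0 cA.
have m2 x0 := fiber_measurable u x0 cS.
have mshift : measurable ([set t | fiber A u (x - w') (t - s)] : set (measurableTypeR R)).
  by rewrite -fiber_shifted; apply: fiber_measurable; exact: compact_shifted.
have le1 : (lambda (fiber (A `&` shifted A w) u x) <= lambda (fiber A u x))%E.
  by rewrite fA; exact: measureIl.
have le2 : (lambda (fiber (A `&` shifted A w) u x) <= lambda (fiber A u (x - w')))%E.
  by rewrite fA -[leRHS](lebesgue_measure_shift (- s))//; exact: measureIr.
rewrite fS.
have [ne|/set0P/negP/negPn/eqP e0] := pselect (fiber A u x !=set0); last first.
  by rewrite (le_trans le1)// e0 measure0.
have [ne'|/set0P/negP/negPn/eqP e0] := pselect (fiber A u (x - w') !=set0); last first.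
  by rewrite (le_trans le2)// e0 measure0.
have [L12|/ltW L21] := leP (lambda (fiber A u x)) (lambda (fiber A u (x - w'))).
  have sub : fiber (steiner u A) u x `<=` fiber (steiner u A) u (x - w').
    move=> t; rewrite /fiber/= !steinerP// => -[_ le]; split => //.
    by rewrite (le_trans le)// lee_pmul2l.
  by rewrite (setIidl sub) steiner_fiber_measure.
have sub : fiber (steiner u A) u (x - w') `<=` fiber (steiner u A) u x.
  move=> t; rewrite /fiber/= !steinerP// => -[_ le]; split => //.
  by rewrite (le_trans le)// lee_pmul2l.
by rewrite (setIidr sub) steiner_fiber_measure.
Qed.

Lemma steiner_translation_loss n (A : set 'rV[R]_n.+1) u w K :
  dotv u u = 1 -> compact A ->
  translation_loss_le A w K -> translation_loss_le (steiner u A) (perp u w) K.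
Proof.
move=> u1 cA AK h; rewrite leb_steiner// (le_trans (AK h))// leeD2r//.
have <- : perp u (h *: w) = h *: perp u w.
  by rewrite /perp dotvZl scalerBr scalerA.
exact: steiner_overlap.
Qed.


Lemma lebesgue_measure_itv_loss (I : set R) (a h : R) :
  I = `[- a, a]%classic ->
  (lambda I <= lambda (I `&` [set t | I (t - h)%R]) + `|h|%:E)%E.
Proof.
move=> IE; have mI : measurable (I : set (measurableTypeR R)) by rewrite IE; exact: measurable_itv.
have mI' : measurable ([set t | I (t - h)] : set (measurableTypeR R)).
  apply: measurable_preimage mI; exact: measurable_funD.
rewrite [leLHS](measureDI _ mI mI') addeC leeD2l//.
have [h0|h0] := leP 0 h.
  apply: (@le_trans _ _ (lambda [set` `[- a, - a + h[])).
    apply: le_measure; rewrite ?inE; [exact: measurableD|exact: measurable_itv|].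
    move=> t; rewrite IE /= !in_itv/= => -[/andP[t1 t2] /negP].
    by rewrite negb_and -!ltNge => /orP[?|?]; apply/andP; split; lra.
  rewrite lebesgue_measure_itv/= lte_fin; case: ifPn => _; rewrite ?lee_fin//.
  by rewrite ger0_norm//; lra.
apply: (@le_trans _ _ (lambda [set` `]a + h, a]])).
  apply: le_measure; rewrite ?inE; [exact: measurableD|exact: measurable_itv|].
  move=> t; rewrite IE /= !in_itv/= => -[/andP[t1 t2] /negP].
  by rewrite negb_and -!ltNge => /orP[?|?]; apply/andP; split; lra.
rewrite lebesgue_measure_itv/= lte_fin; case: ifPn => _; rewrite ?lee_fin//.
by rewrite ltr0_norm//; lra.
Qed.

(** Each fiber of the symmetral is an interval and loses at most [`|h|] when
moved by [h]; the fibers are indexed by the projection onto the hyperplane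
orthogonal to [u], which lies in a ball of the same radius one dimension below. *)
Lemma steiner_self_loss n (A : set 'rV[R]_n.+1) u c r : dotv u u = 1 ->
  compact A -> 0 <= r -> A `<=` eball c r ->
  translation_loss_le (steiner u A) u (fine (unit_ball_volume R n) * r ^+ n).
Proof.
move=> u1 cA r0 Ac h; have [Q QQ Qu] := orthogonal_extension u1.
have cS := steiner_compact u1 cA.
have mS := compact_rV_measurable cS.
have mI : measurable (steiner u A `&` shifted (steiner u A) (h *: u)).
  by apply: compact_rV_measurable; apply: compactI_rV => //; exact: compact_shifted.
have [b bE] := perp_hyperplane QQ Qu c.
have mb : measurable (eball b r) by exact: measurable_eball.
have -> : (fine (unit_ball_volume R n) * r ^+ n * `|h|)%:E =
    (\int[leb n]_y (`|h| * \1_(eball b r) y)%:E)%E :> \bar R.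
  under eq_integral do rewrite EFinM.
  rewrite ge0_integralZl_EFin//; last exact/measurable_EFinP.
  have -> : (\int[leb n]_y (\1_(eball b r) y)%:E = leb n (eball b r))%E.
    by rewrite integral_indic// setIT.
  rewrite leb_eball// -[in RHS](fineK (@unit_ball_volume_fin_num R n)).
  by rewrite -!EFinM; congr (_%:E); ring.
have mloss : measurable_fun setT (fun y : 'rV[R]_n => (`|h| * \1_(eball b r) y)%:E).
  by apply/measurable_EFinP; apply: measurable_funM.
rewrite !(leb_fibers QQ Qu)// -ge0_integralD//; last exact: (measurable_fibers Qu mI).
apply: ge0_le_integral => //.
- exact: (measurable_fibers Qu mS).
- by apply: emeasurable_funD => //; exact: (measurable_fibers Qu mI).
move=> y _; rewrite fiberI -[h *: u]add0r fiber_shifted subr0.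
have yu := dotv_hyperplane QQ Qu y; set x := hyperplane Q y in yu *.
have [ne|e] := pselect (fiber A u x !=set0); last first.
  rewrite steiner_fiber0// measure0; apply: adde_ge0; first exact: measure_ge0.
  by rewrite lee_fin mulr_ge0.
rewrite (le_trans (lebesgue_measure_itv_loss h (steiner_fiber_itv u1 cA yu ne)))//.
rewrite leeD2l// lee_fin indicE mem_set ?mulr1//.
have Sx : steiner u A x.
  rewrite -[x]addr0 -(scale0r u) steinerP// normr0; split => //.
  by rewrite mule_ge0.
have := steiner_eball u1 cA r0 Ac Sx.
by rewrite /eball/= !enorm_le// bE hyperplane_isometry.
Qed.

End translation_loss.

(** * Integrals over translated sets *)

Section directional_integral.
Context {R : realType} {n : nat}.
Implicit Types (B : set 'rV[R]_n) (w x : 'rV[R]_n).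

Lemma continuous_bounded_on B (f : 'rV[R]_n -> R) : continuous f -> compact B ->
  exists2 M, 0 <= M & forall x, B x -> `|f x| <= M.
Proof.
move=> cf cB; have cI : compact (f @` B).
  by apply: continuous_compact cB; exact: continuous_subspaceT.
have [M [_ BM]] := compact_bounded cI.
exists (`|M| + 1) => [|x Bx]; first by rewrite addr_ge0.
by apply: BM; [rewrite (le_lt_trans (ler_norm _))// ltrDl|exists x].
Qed.

Lemma continuous_integrable B (f : 'rV[R]_n -> R) : continuous f -> compact B ->
  (leb n).-integrable B (EFin \o f).
Proof.
move=> cf cB; have [M M0 fM] := continuous_bounded_on cf cB.
apply: measurable_bounded_integrable.
- exact: compact_rV_measurable.
- exact: compact_leb_lty.
- by apply: measurable_funTS; exact: continuous_rV_measurable.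
- exists M; split; first exact: num_real.
  by move=> N MN x Bx /=; rewrite (le_trans (fM _ Bx))// ltW.
Qed.

Lemma leb_shifted B a : measurable B -> leb n (shifted B a) = leb n B.
Proof. exact: leb_shift. Qed.

(** Invariance of Lebesgue measure under the translation by [a]. *)
Lemma ge0_integral_shift B (f : 'rV[R]_n -> R) a : compact B -> continuous f ->
  (forall x, 0 <= f x) ->
  (\int[leb n]_(x in B) (f (x + a)%R)%:E = \int[leb n]_(x in shifted B a) (f x)%:E)%E.
Proof.
move=> cB cf f0.
have mB' : measurable (shifted B a) by apply: compact_rV_measurable; exact: compact_shifted.
have mf : measurable_fun setT (EFin \o f) by apply/measurable_EFinP; exact: continuous_rV_measurable.
have pushE := @ge0_integral_pushforward _ _ _ _ R _ (measurable_addr a) (leb n) (shifted B a)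
  (EFin \o f) mB' (measurable_funTS mf) (fun x _ => f0 x).
transitivity (\int[leb n]_(x in (fun x => x + a)%R @^-1` shifted B a) (f (x + a)%R)%:E)%E.
  by congr (integral _ _ _); apply/seteqP; split => x; rewrite /shifted/= addrK.
rewrite -[LHS]pushE; apply: eq_measure_integral; first exact: measurable_addr.
by move=> mphi A mA _; exact: (leb_shift a mA).
Qed.

(** Moving the translation to the set, only the part of the translated set
outside [B] matters: its volume is at most [K |h|], and [f <= M] there. *)
Lemma integral_shift_le B (f : 'rV[R]_n -> R) w K M h : compact B ->
  continuous f -> (forall x, 0 <= f x <= M) -> translation_loss_le B w K ->
  (\int[leb n]_(x in B) (f (x + h *: w)%R)%:E <=
   \int[leb n]_(x in B) (f x)%:E + (M * (K * `|h|))%:E)%E.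
Proof.
move=> cB cf fM BK; set a := h *: w.
have f0 x : 0 <= f x by case/andP: (fM x).
have M0 : 0 <= M by case/andP: (fM 0) => h1 h2; exact: le_trans h1 h2.
have mB := compact_rV_measurable cB.
have mB' : measurable (shifted B a) by apply: compact_rV_measurable; exact: compact_shifted.
have mf : measurable_fun setT (EFin \o f) by apply/measurable_EFinP; exact: continuous_rV_measurable.
have lossE : (leb n (shifted B a `\` B) <= (K * `|h|)%:E)%E.
  have cB' : compact (shifted B a) by exact: compact_shifted.
  have -> : (leb n (shifted B a `\` B) =
      leb n (shifted B a) - leb n (shifted B a `&` B))%E.
    by apply: measureD => //; exact: compact_leb_lty.
  rewrite leb_shifted// setIC leeBlDl; first exact: BK.
  by rewrite ge0_fin_numE// compact_leb_lty//; exact: compactI_rV.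
rewrite ge0_integral_shift// -(setUIDK (shifted B a) B).
rewrite ge0_integral_setU//; first last.
- by apply/disj_setPS => x [[_ Bx] []].
- by move=> x _; rewrite lee_fin.
- exact: measurable_funTS.
- exact: measurableD.
- exact: measurableI.
apply: leeD.
  apply: ge0_subset_integral => //; first exact: measurableI.
  - exact: measurable_funTS.
  - by move=> x _; rewrite lee_fin.
apply: (@le_trans _ _ (\int[leb n]_(x in shifted B a `\` B) (cst M%:E) x)%E).
  apply: ge0_le_integral => //; first exact: measurableD.
  - by move=> x _; rewrite lee_fin.
  - exact: measurable_funTS.
  - by move=> x _; rewrite lee_fin; case/andP: (fM x).
rewrite integral_cst; last exact: measurableD.
by rewrite EFinM lee_pmul.
Qed.

End directional_integral.

(** * Integrals of directional derivatives *)

Section derivative.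
Context {R : realType} {n : nat}.
Implicit Types (B : set 'rV[R]_n) (w x : 'rV[R]_n).

Lemma continuous_shift (f : 'rV[R]_n -> R) w : continuous f ->
  continuous (fun x => f (x + w)).
Proof.
move=> cf x; apply: (@continuous_comp _ _ _ (fun x => x + w) f); last exact: cf.
apply: (@continuousD _ _ _ (fun x => x) (fun=> w)); first exact: cvg_id.
exact: (@cst_continuous _ _ w x).
Qed.

Lemma is_derive_line (g : 'rV[R]_n -> R) x w t : derivable g (x + t *: w) w ->
  is_derive t 1 (fun s => g (x + s *: w)) ('D_w g (x + t *: w)).
Proof.
have E : (fun h => h^-1 *: (g (x + (h *: 1 + t) *: w) - g (x + t *: w))) =
    (fun h => h^-1 *: (g (h *: w + (x + t *: w)) - g (x + t *: w))) :> (R -> R).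
  by apply/funext => h; rewrite [h *: 1]mulr1 scalerDl addrCA.
by move=> dg; apply: DeriveDef; rewrite /derivable /derive E.
Qed.

(** By the mean value theorem a difference quotient is a value of the
derivative within distance [|w|] of [B]. *)
Lemma difference_quotient_bounded B (g : 'rV[R]_n -> R) w :
  compact B -> continuous g -> (forall x, derivable g x w) ->
  continuous (fun x => 'D_w g x) ->
  exists2 M, 0 <= M & forall x h, B x -> 0 < h <= 1 ->
    `|h^-1 * (g (x + h *: w) - g x)| <= M.
Proof.
move=> cB cg dg cDg; have [r [_ Br]] := compact_bounded cB.
pose C := [set y : 'rV[R]_n | `|y| <= r + 1 + `|w|].
have cC : compact C.
  apply: bounded_closed_compact.
    exists (r + 1 + `|w|); split; first exact: num_real.
    by move=> N rN y /= yr; rewrite (le_trans yr)// ltW.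
  apply: (@preimage_closed _ _ (fun x : 'rV[R]_n => `|x|) [set t | t <= r + 1 + `|w|]).
    by move=> x _; exact: norm_continuous.
  exact: closed_le.
have [M M0 MC] := continuous_bounded_on cDg cC.
exists M => // x h Bx /andP[h0 h1].
have [||s sh E] := @MVT_segment R (fun s => g (x + s *: w)) (fun s => 'D_w g (x + s *: w)) 0 h (ltW h0).
- by move=> t _; exact: is_derive_line.
- apply: continuous_subspaceT => s.
  apply: (@continuous_comp _ _ _ (fun s : R => x + s *: w) g); last exact: cg.
  exact: continuous_line.
move: E; rewrite scale0r addr0 subr0 => ->.
rewrite mulrC mulfK ?gt_eqF//; apply: MC; rewrite /C/=.
rewrite (le_trans (ler_normD _ _))// lerD//; first by apply: Br; rewrite ?ltrDl.
move: sh; rewrite in_itv/= => /andP[s0 sh].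
by rewrite normrZ ger0_norm// ler_piMl// (le_trans sh).
Qed.

Lemma harmonic_le1 k : 0 < (harmonic k : R) <= 1.
Proof. by rewrite /harmonic/= invr_gt0 ltr0n/= invf_le1 ?ltr0n// ler1n. Qed.

(** The difference quotients converge boundedly to the derivative, and moving
the difference from the function to the set bounds their integrals. *)
Lemma directional_integral_le B (g : 'rV[R]_n -> R) w K c :
  compact B -> continuous g -> (forall x, derivable g x w) ->
  continuous (fun x => 'D_w g x) -> (forall x, `|g x| <= c) ->
  translation_loss_le B w K ->
  (\int[leb n]_(x in B) ('D_w g x)%:E <= (2 * c * K)%:E)%E.
Proof.
move=> cB cg dg cDg gc BK; have mB := compact_rV_measurable cB.
pose f k x := (harmonic k)^-1 * (g (x + harmonic k *: w) - g x).
have cgs k : continuous (fun x => g (x + harmonic k *: w)) by exact: continuous_shift.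
have mcont (h : 'rV[R]_n -> R) : continuous h -> measurable_fun B (EFin \o h).
  by move=> ch; apply/measurable_funTS/measurable_EFinP; exact: continuous_rV_measurable.
have mf k : measurable_fun B (EFin \o f k).
  apply/measurable_EFinP; apply: measurable_funM => //.
  by apply: measurable_funB; apply/measurable_EFinP; exact: mcont.
have [M M0 fM] := difference_quotient_bounded cB cg dg cDg.
have f_cvg x : (EFin \o f^~ x) k @[k --> \oo] --> ('D_w g x)%:E.
  apply/fine_cvgP; split; first exact: nearW.
  have /cvgr_dnbhsP/(_ harmonic) : h^-1 *: (g (h *: w + x) - g x) @[h --> 0^'] --> 'D_w g x.
    exact: dg.
  rewrite /f /=; under [X in _ -> X @ _ --> _]eq_fun do rewrite [x + _]addrC.
  apply; split; last exact: cvg_harmonic.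
  by move=> k; rewrite gt_eqF//; case/andP: (harmonic_le1 k).
have [|||_ _ lim] := @dominated_convergence _ _ _ (leb n) B mB (fun k => EFin \o f k)
  (EFin \o (fun x => 'D_w g x)) (EFin \o cst M) mf (mcont _ cDg).
- by apply: aeW => x _; exact: f_cvg.
- by apply: continuous_integrable => //; exact: cst_continuous.
- by apply: aeW => x k Bx; rewrite lee_fin; apply: fM => //; exact: harmonic_le1.
apply: cvge_le lim; apply: nearW => k /=.
have [h0 h1] := andP (harmonic_le1 k); set h := harmonic k in h0 h1 *.
(* Adding a constant does not change the difference quotient and makes the
   function take its values in [0, 2 c]. *)
pose G x := g x + c.
have cG : continuous G.
  by move=> x; apply: (@continuousD _ _ _ g (fun=> c)); [exact: cg|exact: (@cst_continuous _ _ c x)].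
have cGs : continuous (fun x => G (x + h *: w)) by exact: continuous_shift.
have GM x : 0 <= G x <= 2 * c.
  by move: (gc x); rewrite ler_norml /G => /andP[? ?]; apply/andP; split; lra.
have -> : (\int[leb n]_(x in B) (f k x)%:E = (h^-1)%:E *
    (\int[leb n]_(x in B) (G (x + h *: w)%R)%:E - \int[leb n]_(x in B) (G x)%:E))%E.
  rewrite -integralB_EFin//; [|exact: continuous_integrable..].
  rewrite -integralZl//.
    apply: eq_integral => x _; rewrite -EFinB -EFinM; congr (_%:E); rewrite /f /G -/h; ring.
  by apply: integrableB => //; exact: continuous_integrable.
have /= := integral_shift_le h cB cG GM BK.
have Gfin : (\int[leb n]_(x in B) (G x)%:E \is a fin_num)%E.
  by apply: integrable_fin_num => //; exact: continuous_integrable.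
have Gsfin : (\int[leb n]_(x in B) (G (x + h *: w)%R)%:E \is a fin_num)%E.
  by apply: integrable_fin_num => //; exact: continuous_integrable.
rewrite -(fineK Gfin) -(fineK Gsfin) -EFinD -EFinB -EFinM !lee_fin (gtr0_norm h0).
by rewrite ler_pdivrMl//; lra.
Qed.

End derivative.

(** * From translation losses to the perimeter *)

Section perimeter_bound.
Context {R : realType} {n : nat}.

Lemma derivable_dotv (F : 'rV[R]_n -> 'rV[R]_n) a x v : derivable F x v ->
  derivable (fun y => dotv (F y) a) x v /\
  'D_v (fun y => dotv (F y) a) x = dotv ('D_v F x) a.
Proof.
move=> dF; have : h^-1 *: (dotv (F (h *: v + x)) a - dotv (F x) a) @[h --> 0^'] -->
    dotv ('D_v F x) a.
  rewrite (_ : (fun h => _) =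
    (fun y => dotv y a) \o (fun h => h^-1 *: (F (h *: v + x) - F x))); last first.
    by apply/funext => h /=; rewrite !dotv_lin.
  by apply: cvg_comp; [exact: dF|exact: continuous_dotvr].
move=> lim; split; first by apply/cvg_ex; exists (dotv ('D_v F x) a).
exact: cvg_lim lim.
Qed.

Lemma divergenceE (F : 'rV[R]_n -> 'rV[R]_n) x : differentiable F x ->
  divergence F x = \tr (lin1_mx ('d F x)).
Proof.
move=> dF; apply: eq_bigr => j _; rewrite mxE -deriveE//.
by rewrite derive_mx ?mxE//; exact: diff_derivable.
Qed.

(** Expanding [F] in the basis formed by the rows of [W] writes its divergence
as a sum of directional derivatives along the rows, since a trace does not
depend on the basis. *)
Lemma divergence_basis (F : 'rV[R]_n -> 'rV[R]_n) (W : 'M[R]_n) x :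
  W \in unitmx -> differentiable F x ->
  divergence F x =
  \sum_i 'D_(row i W) (fun y => dotv (F y) (row i (invmx W)^T)) x.
Proof.
move=> uW dF; rewrite divergenceE//; set J := lin1_mx _.
have -> : \tr J = \tr (W *m J *m invmx W).
  by rewrite mxtrace_mulC mulmxA mulVmx// mul1mx.
apply: eq_bigr => i _.
have dv : derivable F x (row i W) by exact: diff_derivable.
have [_ ->] := derivable_dotv (row i (invmx W)^T) dv.
rewrite deriveE// -mul_rV_lin1 -/J dotvE mxE [RHS]mxE; apply: eq_bigr => j _.
by rewrite -row_mul !mxE.
Qed.

(** The coordinates of a test field in the basis of the rows of [W] are bounded
by [1 / |det W|]. *)
Lemma perimeter_le (B : set 'rV[R]_n) (W : 'M[R]_n) K : compact B -> \det W != 0 ->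
  (forall i, dotv (row i W) (row i W) <= 1) ->
  (forall i, translation_loss_le B (row i W) K) ->
  (perimeter B <= (n%:R * (2 * `|\det W|^-1 * K))%:E)%E.
Proof.
move=> cB W0 W1 BK; have uW : W \in unitmx by rewrite unitmxE unitfE.
apply: ub_ereal_sup => _ [F [smF _ F1] <-].
have cF : continuous F := smF 0%N.
have [dF cDF] := smF 1%N.
pose a i := row i (invmx W)^T; pose g i x := dotv (F x) (a i).
have dg i x v : derivable (g i) x v /\ 'D_v (g i) x = dotv ('D_v F x) (a i).
  by apply: derivable_dotv; exact: diff_derivable.
have cg i : continuous (g i).
  by apply: continuous_dotv => //; exact: cst_continuous.
have cDg i v : continuous (fun x => 'D_v (g i) x).
  rewrite (_ : (fun x => _) = (fun x => dotv ('D_v F x) (a i))).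
    by apply: continuous_dotv; [exact: cDF|exact: cst_continuous].
  by apply/funext => x; case: (dg i x v).
have g1 i x : `|g i x| <= `|\det W|^-1.
  rewrite (_ : g i x = (F x *m invmx W) 0 i).
    apply: coordinate_le_inv_det => //.
    by have := F1 x; rewrite enorm_le// expr1n.
  by rewrite /g dotvE !mxE; apply: eq_bigr => j _; rewrite !mxE.
rewrite (eq_integral (fun x => \sum_i ('D_(row i W) (g i) x)%:E)%E); last first.
  by move=> x _; rewrite (divergence_basis uW (dF x)) sumEFin.
have mB := compact_rV_measurable cB.
rewrite integral_sum//; last first.
  by move=> i; exact: (continuous_integrable (cDg i (row i W)) cB).
rewrite (@le_trans _ _ (\sum_(i < n) (2 * `|\det W|^-1 * K)%:E)%E)//.
  apply: lee_sum => i _; apply: directional_integral_le => // x.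
  by case: (dg i x (row i W)).
by rewrite sumEFin sumr_const card_ord -[X in (X%:E <= _)%E]mulr_natl.
Qed.

End perimeter_bound.

(** * Iterated symmetrization *)

Section iteration.
Context {R : realType} {n : nat}.
Implicit Types (W : 'M[R]_n) (k : 'I_n).

(** The row operations multiply [W] by a unitriangular matrix, whose
coefficients off the diagonal lie in column [k] above the diagonal. *)
Lemma det_row_sub W (a : 'I_n -> R) k :
  \det (\matrix_i (if (i < k)%N then row i W - a i *: row k W else row i W)) = \det W.
Proof.
pose C : 'M[R]_n := \matrix_(i, j) (if (j == k) && (i < k)%N then a i else 0).
have -> : \matrix_i (if (i < k)%N then row i W - a i *: row k W else row i W) =
    (1%:M - C) *m W.
  apply/row_matrixP => i; rewrite rowK row_mul linearB/= mulmxBl -row_mul mul1mx.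
  have -> : row i C *m W = (if (i < k)%N then a i else 0) *: row k W.
    rewrite [LHS](mulmx_sum_row) (bigD1 k)//= big1 ?addr0.
      by rewrite !mxE eqxx.
    by move=> j jk; rewrite !mxE (negbTE jk) scale0r.
  by case: ifP => _; rewrite // scale0r subr0.
rewrite det_mulmx -det_tr det_trig.
  rewrite big1 ?mul1r// => i _; rewrite !mxE eqxx.
  by case: ifP => [/andP[/eqP ->]|]; rewrite ?ltnn ?subr0.
apply/is_trig_mxP => i j ij; rewrite !mxE.
have -> : (j == i) = false by apply/eqP => ji; move: ij; rewrite ji ltnn.
case: ifP => [/andP[/eqP <- ji]|_]; last by rewrite subr0.
by move: (ltn_trans ij ji); rewrite ltnn.
Qed.

Lemma free_det (u : 'I_n -> 'rV[R]_n) : free [seq u i | i : 'I_n] ->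
  \det (\matrix_i u i) != 0.
Proof.
move=> fu; have /freeP fr : free [tuple u i | i < n] by [].
apply/negP => /det0P[v v0 vU]; move/eqP: v0; apply; apply/rowP => i; rewrite mxE.
apply: (fr (fun i => v 0 i)); rewrite -[RHS]vU mulmx_sum_row.
by apply: eq_bigr => j _; rewrite rowK (nth_map j) ?size_enum_ord// nth_ord_enum.
Qed.

End iteration.
(** The vectors of the first [k] steps are projected successively onto the
orthogonal complements of the later ones. This keeps the determinant and does
not increase lengths, and each projected vector inherits the bound that its
own symmetrization produced. *)
Lemma iterated_translation_loss (R : realType) m (A : set 'rV[R]_m.+1) c r
    (u : 'I_m.+1 -> 'rV[R]_m.+1) (k : nat) :
  compact A -> 0 <= r -> A `<=` eball c r -> (forall i, dotv (u i) (u i) = 1) ->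
  (k <= m.+1)%N ->
  let B := iter_steiner (take k [seq u i | i : 'I_m.+1]) A in
  [/\ compact B, exists c', B `<=` eball c' r &
    exists W : 'M[R]_m.+1, [/\ \det W = \det (\matrix_i u i),
      forall i, dotv (row i W) (row i W) <= 1,
      forall i : 'I_m.+1, (k <= i)%N -> row i W = u i &
      forall i : 'I_m.+1, (i < k)%N ->
        translation_loss_le B (row i W) (fine (unit_ball_volume R m) * r ^+ m)]].
Proof.
move=> cA r0 Ac u1; elim: k => [_|k IH km] /=.
  rewrite take0; split => //; first by exists c.
  exists (\matrix_i u i); split => // i; first by rewrite rowK u1.
  by move=> _; rewrite rowK.
have [cB [c' Bc'] [W [detW W1 Wu WB]]] := IH (ltnW km).
pose kk := Ordinal km; set us := [seq u i | i : 'I_m.+1].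
have -> : iter_steiner (take k.+1 us) A = steiner (u kk) (iter_steiner (take k us) A).
  rewrite (take_nth 0); last by rewrite size_map size_enum_ord.
  rewrite /iter_steiner foldl_rcons (nth_map kk) ?size_enum_ord//.
  by rewrite (_ : nth kk _ k = kk)//; apply/val_inj; rewrite /= nth_enum_ord.
set B := iter_steiner _ _ in cB Bc' WB *.
split; first exact: steiner_compact.
  by exists (perp (u kk) c'); exact: steiner_eball.
(* The row of index [k] is still [u k], so projecting along [u k] is a row
   operation. *)
pose a i := dotv (row i W) (u kk).
exists (\matrix_i (if (i < kk)%N then row i W - a i *: row kk W else row i W)).
have rowE (i : 'I_m.+1) : row i (\matrix_i (if (i < kk)%N then row i W - a i *: row kk W else row i W)) =
    if (i < k)%N then perp (u kk) (row i W) else row i W.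
  by rewrite rowK (Wu kk).
split.
- by rewrite det_row_sub.
- move=> i; rewrite rowE; case: ifP => _; last exact: W1.
  by rewrite (le_trans (dotv_perp_le _ (u1 kk))).
- by move=> i ki; rewrite rowE ltnNge (ltnW ki)/= Wu// ltnW.
move=> i; rewrite ltnS leq_eqVlt rowE => /predU1P[ik|ik].
  rewrite ik ltnn (_ : i = kk); last exact/val_inj.
  by rewrite Wu//; apply: steiner_self_loss Bc'.
by rewrite ik; apply: steiner_translation_loss => //; exact: WB.
Qed.

Theorem theorem1 (R : realType) (n : nat) (hn : (2 <= n)%N)
    (A : set 'rV[R]_n) (hA : compact A)
    (r : R) (hr : is_outradius A r)
    (u : 'I_n -> 'rV[R]_n) (hu : forall i, enorm (u i) = 1)
    (hfree : free [seq u i | i : 'I_n]) :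
  (perimeter (iter_steiner [seq u i | i : 'I_n] A)
   <= (2 * n%:R)%:E * unit_ball_volume R n.-1
      * (r ^+ n.-1 / `|\det (\matrix_(i < n, j < n) u j 0 i)|)%:E)%E.
Proof.
case: n hn A hA hr u hu hfree => // m _ A hA [[r0 [c Ac]] _] u hu hfree.
have u1 i := enorm1P (hu i).
have U0 := free_det hfree.
have := iterated_translation_loss hA r0 Ac u1 (leqnn m.+1).
rewrite take_oversize; last by rewrite size_map size_enum_ord.
move=> [cB _ [W [detW W1 _ WB]]].
have W0 : \det W != 0 by rewrite detW.
apply: le_trans (perimeter_le cB W0 W1 (fun i => WB i (ltn_ord i))) _.
have -> : \matrix_(i < m.+1, j < m.+1) u j 0 i = (\matrix_i u i)^T.
  by apply/matrixP => i j; rewrite !mxE.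
rewrite det_tr -detW -[X in (_ <= _ * X * _)%E](fineK (@unit_ball_volume_fin_num R m)).
rewrite -!EFinM lee_fin/= le_eqVlt; apply/orP; left; apply/eqP.
by field; rewrite normr_eq0.
Qed.
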